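(* Let $\mathbb{B}$ be a separable Banach space ordered by a cone $\mathcal{K}$ with nonempty interior, let $X\subset\mathbb{B}$ be p-convex, and let $\Phi$ be a strongly order preserving semiflow on $X$ such that, for some fixed $t_0\ge0$ and every $t\ge t_0$, the map $\Phi_t$ is compact, (Fréchet) $C^1$, and has compact derivatives. Suppose in addition that every orbit has compact closure in $X$ (that is, $B=X$), that $X$ is order convex, that every equilibrium is irreducible, and that $\Phi$ is eventually strongly monotone. Then $C_s$ is prevalent in $X$, i.e. $X\setminus C_s$ is shy in $\mathbb{B}$.
   Context: An order cone $\mathcal{K}\subset\mathbb{B}$ is a closed convex cone with $\mathcal{K}\cap(-\mathcal{K})=\{0\}$ and $\mathcal{K}\ne\{0\}$. Write $x\le y$ iff $y-x\in\mathcal{K}$; $x<y$ iff $x\le y$, $x\ne y$; $x\ll y$ iff $y-x\in\mathrm{Int}\,\mathcal{K}$; for sets, $A\le A'$ means $a\le a'$ for all $a\in A$, $a'\in A'$. $A\subseteq\mathbb{B}$ is p-convex if $x,y\in A$, $x<y$ imply $tx+(1-t)y\in A$ for $0<t<1$; it is order convex if $x,y\in A$ and $x\le z\le y$ imply $z\in A$. A semiflow on $X$ is a continuous map $\Phi:[0,\infty)\times X\to X$, $(t,x)\mapsto\Phi_t(x)$, with $\Phi_0=\mathrm{id}$, $\Phi_t\circ\Phi_s=\Phi_{t+s}$. It is monotone if $x\le y$ implies $\Phi_t(x)\le\Phi_t(y)$ for $t\ge0$; eventually strongly monotone if it is monotone and there is $t_1\ge0$ such that $x<y$ implies $\Phi_t(x)\ll\Phi_t(y)$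 for $t\ge t_1$; strongly order preserving if it is monotone and whenever $x<y$ there are open subsets $U\ni x$, $V\ni y$ of $X$ and $s\ge0$ with $\Phi_s(U)\le\Phi_s(V)$. $\omega(x)$ is the omega limit set of $x$, $E$ the set of equilibria (points fixed by all $\Phi_t$). $\Phi_t'(x)$, a bounded linear operator on $\mathbb{B}$, is the Fréchet derivative of $\Phi_t$ at $x$ (taken relative to $X$ if $X$ is not open, and assumed uniquely determined). An equilibrium $e$ is irreducible if for some $t=t_e>0$ the operator $\Phi_t'(e)$ is strongly positive, i.e. $x>0$ implies $\Phi_t'(e)x\gg0$. With $\rho$ the spectral radius, $E_s=\{e\in E:\rho(\Phi'_{t_0}(e))\le1\}$ and $C_s=\{x\in X:\omega(x)=\{e\}\text{ for some }e\in E_s\}$. A set $W\subseteq\mathbb{B}$ is shy if there is a nontrivial compactly supported Borel measure $\mu$ on $\mathbb{B}$ with $\mu(W+x)=0$ for every $x\in\mathbb{B}$ (for a set that is not Borel, $\mu(S)=0$ means that $S$ is contained in a Borel set of $\mu$-measure zero). $W$ is prevalent in $A$ if $A\setminus W$ is shy. *)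

(* Defs.v *)
From HB Require Import structures.
From mathcomp Require Import all_boot all_order all_algebra.
From mathcomp Require Import complex.
From mathcomp Require Import all_classical all_reals all_analysis.

Set Implicit Arguments.
Unset Strict Implicit.
Unset Printing Implicit Defensive.

Import Order.TTheory GRing.Theory Num.Theory.
Import numFieldNormedType.Exports.

Local Open Scope classical_set_scope.
Local Open Scope ring_scope.

Definition separable (T : topologicalType) : Prop :=
  exists2 S : set T, countable S & dense S.

Section Order.
Context {R : realType} {B : normedModType R}.
Implicit Types (K A : set B) (x y : B).

Record order_cone K : Prop := OrderCone {
  order_cone_closed : closed K ;
  order_cone0 : K 0 ;
  order_coneD : forall x y, K x -> K y -> K (x + y) ;
  order_coneZ : forall (a : R) x, 0 <= a -> K x -> K (a *: x) ;
  order_cone_pointed : K `&` [set - x | x in K] = [set 0] ;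
  order_cone_neq0 : K <> [set 0] }.

Definition cone_le K x y : Prop := K (y - x).
Definition cone_lt K x y : Prop := cone_le K x y /\ x <> y.
Definition cone_ll K x y : Prop := K° (y - x).

Definition set_le K A A' : Prop :=
  forall a a', A a -> A' a' -> cone_le K a a'.

Definition p_convex K A : Prop :=
  forall x y (t : R), A x -> A y -> cone_lt K x y -> 0 < t -> t < 1 ->
    A (t *: x + (1 - t) *: y).

Definition order_convex K A : Prop :=
  forall x y z, A x -> A y -> cone_le K x z -> cone_le K z y -> A z.

Definition strongly_positive K (L : B -> B) : Prop :=
  forall x, cone_lt K 0 x -> cone_ll K 0 (L x).

End Order.

Section Calculus.
Context {R : realType} {B : normedModType R}.
Implicit Types (X : set B) (f : B -> B) (x : B) (L : {linear B -> B}).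

(* [L] is a Frechet derivative at [x] of the restriction of [f] to [X]; for
   [x] in the interior of [X] this is the usual derivative. *)
Definition is_frechet X f x L : Prop :=
  continuous L /\
  (fun y => f y - f x - L (y - x)) =o_ (within X (nbhs x)) (fun y => y - x).

(* The near-statement is convergence of [D y] to [D x] in operator norm. *)
Definition C1_on X f : Prop :=
  exists D : B -> {linear B -> B},
    (forall x, X x -> is_frechet X f x (D x)) /\
    (forall x, X x -> forall e : R, 0 < e ->
      \forall y \near within X (nbhs x),
        forall v, `|D y v - D x v| <= e * `|v|).

(* Relative compactness is taken in [B]; when [f] maps [X] to [X] this is
   implied by relative compactness in [X]. *)
Definition compact_on X f : Prop :=
  forall A, A `<=` X -> bounded_set A -> precompact (f @` A).

(* [L - lambda] on the complexification of [B], where the pair [(u, v)] stands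
   for [u + i v]. *)
Definition complex_shift L (lambda : R[i]) (z : B * B) : B * B :=
  (L z.1 - (complex.Re lambda *: z.1 - complex.Im lambda *: z.2),
   L z.2 - (complex.Re lambda *: z.2 + complex.Im lambda *: z.1)).

Definition spectrum L : set R[i] :=
  [set lambda | ~ exists S : B * B -> B * B,
     [/\ continuous S, cancel (complex_shift L lambda) S
       & cancel S (complex_shift L lambda)]].

Definition spectral_radius L : \bar R :=
  ereal_sup [set (ComplexField.Normc.normc lambda)%:E | lambda in spectrum L].

End Calculus.

Section Semiflow.
Context {R : realType} {B : normedModType R}.
Implicit Types (K X : set B) (Phi : R -> B -> B) (x e : B).

(* A semiflow on [X] is represented by a function on [R * B] whose values
   outside [0, +oo[ * X are irrelevant. *)
Record semiflow X Phi : Prop := Semiflow {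
  semiflow_cont :
    {within [set p : R * B | 0 <= p.1 /\ X p.2],
      continuous (fun p : R * B => Phi p.1 p.2)} ;
  semiflow_stable : forall t x, 0 <= t -> X x -> X (Phi t x) ;
  semiflow0 : forall x, X x -> Phi 0 x = x ;
  semiflowD : forall t s x, 0 <= t -> 0 <= s -> X x ->
    Phi t (Phi s x) = Phi (t + s) x }.

Definition monotone_flow K X Phi : Prop :=
  forall x y t, X x -> X y -> 0 <= t -> cone_le K x y ->
    cone_le K (Phi t x) (Phi t y).

Definition eventually_strongly_monotone K X Phi : Prop :=
  monotone_flow K X Phi /\
  exists2 t1 : R, 0 <= t1 &
    forall x y t, X x -> X y -> cone_lt K x y -> t1 <= t ->
      cone_ll K (Phi t x) (Phi t y).

Definition strongly_order_preserving K X Phi : Prop :=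
  monotone_flow K X Phi /\
  forall x y, X x -> X y -> cone_lt K x y ->
    exists U V : set B, exists s : R,
      [/\ open U /\ U x, open V /\ V y, 0 <= s &
          set_le K (Phi s @` (U `&` X)) (Phi s @` (V `&` X))].

Definition orbit_from Phi (t : R) x : set B :=
  [set Phi s x | s in [set s : R | t <= s]].

Definition orbit_closure X Phi x : set B := X `&` closure (orbit_from Phi 0 x).

Definition omega_limit X Phi x : set B :=
  \bigcap_(t in [set t : R | 0 <= t]) (X `&` closure (orbit_from Phi t x)).

Definition equilibria X Phi : set B :=
  [set e | X e /\ forall t, 0 <= t -> Phi t e = e].

Definition unique_derivatives X Phi : Prop :=
  forall t x (L L' : {linear B -> B}), 0 <= t -> X x ->
    is_frechet X (Phi t) x L -> is_frechet X (Phi t) x L' -> L =1 L'.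

Definition compact_derivatives X (f : B -> B) : Prop :=
  forall x (L : {linear B -> B}), X x -> is_frechet X f x L ->
    compact_on setT L.

Definition irreducible_equilibrium K X Phi e : Prop :=
  exists t : R, exists L : {linear B -> B},
    [/\ 0 < t, is_frechet X (Phi t) e L & strongly_positive K L].

Definition stable_equilibria X Phi (t0 : R) : set B :=
  [set e | equilibria X Phi e /\
     exists2 L : {linear B -> B},
       is_frechet X (Phi t0) e L & (spectral_radius L <= 1)%E].

Definition stably_convergent X Phi (t0 : R) : set B :=
  [set x | X x /\
     exists2 e, stable_equilibria X Phi t0 e & omega_limit X Phi x = [set e]].

End Semiflow.

Section Prevalence.
Context {R : realType} {B : normedModType R}.

Definition borel_type := g_sigma_algebraType (@open B).

(* Borel measures with compact support are taken to be finite, i.e. finite on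
   compact sets: without this, measures with values in {0, +oo} would be
   admissible witnesses of shyness. *)
Definition shy (W : set B) : Prop :=
  exists mu : {finite_measure set borel_type -> \bar R},
    [/\ mu setT <> 0%E,
        exists2 C : set B, compact C & mu (~` C) = 0%E
      & forall x : B, mu.-negligible [set w + x | w in W]].

Definition prevalent_in (W A : set B) : Prop := shy (A `\` W).

End Prevalence.

(* Main.v *)
(* On a line in the direction [v] of the interior of the cone the points whose
   trajectory does not converge to a linearly stable equilibrium are countably
   many, so the image of Lebesgue measure on a segment [[0, v]] is a witness of
   shyness.

   For [x < y] the limit set dichotomy gives [omega x <= omega y], unless
   [omega x = omega y] consists of equilibria and the gap
   [Phi t y - Phi t x] tends to 0. In the latter case the gap cannot shrink
   along a limit set all of whose points are unstable in a positive direction,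
   by order convexity and strict differentiability. If the limit set were not
   a single point, every point of it would be a limit of other, unordered,
   equilibria; the limiting direction would be an eigenvector for 1 of the
   strongly positive derivative outside the cone and its opposite, so that the
   Krein-Rutman eigenvalue would be greater than 1. Hence the common limit set
   is one stable equilibrium.

   Two families remain on the line, both with ordered limit sets: points with
   several limit points, and points converging to pairwise distinct unstable
   equilibria. By separability, if one of them were uncountable it would
   accumulate at one of its members. In the first family two limit points of
   that member would then coincide; in the second the limiting direction would
   be a positive eigenvector for 1, which forces the spectral radius to be at
   most 1. *)
Require Import Defs.
From mathcomp Require Import all_boot all_order all_algebra.
From mathcomp Require Import all_classical all_reals all_analysis.
From mathcomp Require Import complex ring lra.
Import Order.TTheory GRing.Theory Num.Theory.
Import numFieldNormedType.Exports.
Local Open Scope classical_set_scope.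
Local Open Scope ring_scope.

Set Implicit Arguments.
Unset Strict Implicit.
Unset Printing Implicit Defensive.

(** * Order cones *)

(** Filters replace sequences throughout. Refining to an ultrafilter turns the cluster point
    supplied by compactness into a limit, which is the counterpart of extracting a convergent
    subsequence. *)
Lemma compact_refine {I : Type} {T : topologicalType} {F : set_system I}
    {FF : ProperFilter F} {C : set T} {f : I -> T} :
  compact C -> (\forall i \near F, C (f i)) ->
  exists G : set_system I, [/\ ProperFilter G, F `<=` G &
    exists2 l, C l & f @ G --> l].
Proof.
move=> cC FC; have [G [GU FG]] := ultraFilterLemma FF.
have [l [Cl cl]] := cC (f @ G) (fmap_proper_filter f (@ultra_proper _ _ GU)) (FG _ FC).
exists G; split; [exact: ultra_proper|by []|]; exists l => // U Ul.
have [//|nU] := in_ultra_setVsetC (f @^-1` U) GU.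
by have [z []] := cl (~` U) U nU Ul.
Qed.

Lemma norm_cvg_unique {R : realType} {V : normedModType R} {I : Type}
    {F : set_system I} {FF : ProperFilter F} {f : I -> V} {x y : V} :
  f @ F --> x -> f @ F --> y -> x = y.
Proof. by move=> fx fy; exact: (cvg_unique (@norm_hausdorff _ _) fx fy). Qed.

Section OrderCone.
Context {R : realType} {B : normedModType R}.
Variables (K : set B) (hK : order_cone K).
Implicit Types (x y z v h : B).

Lemma cone_intP x : K° x <->
  exists2 e : R, 0 < e & forall h, `|h| <= e -> K (x + h).
Proof.
split.
  move=> /nbhs_normP[e /= e0 He]; exists (e / 2); first by rewrite divr_gt0.
  move=> h hh; apply: He => /=; rewrite opprD addNKr normrN.
  by apply: (le_lt_trans hh); rewrite ltr_pdivrMr// mulr_natr mulr2n ltrDl.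
move=> [e e0 He]; apply/nbhs_normP; exists e => //= y /= xy.
by rewrite -[y](subrK x) addrC; apply: He; rewrite distrC ltW.
Qed.

Lemma cone_int_sub x : K° x -> K x.
Proof. exact: interior_subset. Qed.

Lemma cone_intDl x y : K° x -> K y -> K° (x + y).
Proof.
move=> /cone_intP[e e0 He] Ky; apply/cone_intP; exists e => // h /He Kh.
by rewrite addrAC; exact: order_coneD.
Qed.

Lemma cone_intZ (a : R) x : 0 < a -> K° x -> K° (a *: x).
Proof.
move=> a0 /cone_intP[e e0 He]; apply/cone_intP.
exists (a * e); first exact: mulr_gt0.
move=> h hh; have -> : a *: x + h = a *: (x + a^-1 *: h).
  by rewrite scalerDr scalerA divff ?gt_eqF// scale1r.
apply: (order_coneZ hK); first exact: ltW.
apply: He; rewrite normrZ gtr0_norm ?invr_gt0//.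
by rewrite mulrC ler_pdivrMr// mulrC.
Qed.

Lemma cone_antisym x : K x -> K (- x) -> x = 0.
Proof.
move=> Kx KNx; have : (K `&` [set - x | x in K]) x.
  by split => //; exists (- x) => //; rewrite opprK.
by rewrite (order_cone_pointed hK).
Qed.

Lemma cone_le_antisym x y : cone_le K x y -> cone_le K y x -> x = y.
Proof.
move=> xy yx; apply/esym/eqP; rewrite -subr_eq0; apply/eqP.
by apply: cone_antisym => //; rewrite opprB.
Qed.

Lemma cone_le_trans y x z : cone_le K x y -> cone_le K y z -> cone_le K x z.
Proof.
move=> xy yz; rewrite /cone_le -(subrK y z) -addrA.
exact: (order_coneD hK).
Qed.

(** A ball around 0 inside the cone, after rescaling, puts both [x] and [- x] in the cone, and
    pointedness then leaves only 0. *)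
Lemma cone_int_neq0 : ~ K° 0.
Proof.
move=> /cone_intP[e e0 He]; apply: (order_cone_neq0 hK).
apply/seteqP; split => [x Kx /=|_ ->]; last exact: order_cone0 hK.
have [->//|x0] := eqVneq x 0; apply: cone_antisym => //.
have n0 : 0 < `|x| by rewrite normr_gt0.
have -> : - x = (`|x| / e) *: (- ((e / `|x|) *: x)).
  rewrite scalerN scalerA (_ : _ * _ = 1) ?scale1r//.
  by field; rewrite normr_eq0 x0 gt_eqF.
apply: (order_coneZ hK); first by rewrite divr_ge0// ltW.
rewrite -[X in K X]add0r; apply: He.
by rewrite normrN normrZ ger0_norm ?divr_ge0// ?(ltW e0)// divfK// gt_eqF.
Qed.

Lemma cone_int_gt0 v : K° v -> cone_lt K 0 v.
Proof.
move=> Kv; split; first by rewrite /cone_le subr0; exact: cone_int_sub.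
by move=> v0; apply: cone_int_neq0; rewrite v0.
Qed.

Lemma cone_int_notN v : K° v -> ~ K (- v).
Proof.
move=> Kv KNv; apply: cone_int_neq0.
by rewrite -(cone_antisym (cone_int_sub Kv) KNv).
Qed.

(** An interior point is an order unit, with a constant uniform in [h]. This is how norm estimates
    become order estimates. *)
Lemma cone_unit v : K° v ->
  exists2 c : R, 0 < c & forall h, K ((c * `|h|) *: v + h).
Proof.
move=> /cone_intP[e e0 He]; exists e^-1; first by rewrite invr_gt0.
move=> h; have [->|h0] := eqVneq h 0.
  by rewrite normr0 mulr0 scale0r addr0; exact: order_cone0 hK.
have n0 : 0 < `|h| by rewrite normr_gt0.
have -> : (e^-1 * `|h|) *: v + h = (e^-1 * `|h|) *: (v + (e / `|h|) *: h).
  rewrite scalerDr scalerA [X in _ + X *: h](_ : _ = 1) ?scale1r//.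
  by field; rewrite normr_eq0 h0 gt_eqF.
apply: (order_coneZ hK); first by rewrite mulr_ge0// invr_ge0 ltW.
by apply: He; rewrite normrZ ger0_norm ?divr_ge0// ?(ltW e0)// divfK// gt_eqF.
Qed.

Lemma cone_int_absorb v h : K° v -> exists2 a : R, 0 < a & K (v - a *: h).
Proof.
move=> /cone_intP[e e0 He]; exists (e / (1 + `|h|)).
  by rewrite divr_gt0// ltr_pwDl.
apply: He; rewrite normrN normrZ ger0_norm; last first.
  by rewrite divr_ge0// ltW// ltr_pwDl.
rewrite mulrAC ler_pdivrMr; last by rewrite ltr_pwDl.
by rewrite ler_pM2l// lerDr.
Qed.

Lemma cone_lim {I : Type} {F : set_system I} {FF : ProperFilter F}
    (f : I -> B) x : (\forall i \near F, K (f i)) -> f @ F --> x -> K x.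
Proof. by move=> Ff; exact: (closed_cvg K (order_cone_closed hK) Ff). Qed.

Lemma cone_le_lim {I : Type} {F : set_system I} {FF : ProperFilter F}
    (f g : I -> B) x y : (\forall i \near F, cone_le K (f i) (g i)) ->
  f @ F --> x -> g @ F --> y -> cone_le K x y.
Proof. by move=> fg fx gy; apply: (cone_lim fg); exact: cvgB. Qed.

Lemma cone_geo v z (t q : R) : 0 <= q < 1 ->
  (forall n : nat, K ((t * q ^+ n) *: v - z)) -> K (- z).
Proof.
move=> /andP[q0 q1] H; apply: (@cone_lim _ \oo _ (fun n => (t * q ^+ n) *: v - z)).
  exact: nearW.
rewrite -[X in _ --> X]add0r; apply: cvgB; last exact: cvg_cst.
rewrite -(scale0r v) -(mulr0 t); apply: cvgZl.
by apply: cvgMr; apply: cvg_expr; rewrite ger0_norm.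
Qed.

Lemma cone_arch x v : (forall e : R, 0 < e -> K (x + e *: v)) -> K x.
Proof.
move=> H; apply: (@cone_lim _ (0^'+) _ (fun e : R => x + e *: v)).
  by near=> e; apply: H.
rewrite -[X in _ --> X]addr0 -(scale0r v); apply: cvgD; first exact: cvg_cst.
by apply: cvgZl; apply: cvg_at_right_filter; exact: cvg_id.
Unshelve. all: by end_near. Qed.

(** Take the least [t] with [z <= t v]. It is attained by closedness and positive because [z <= 0]
    fails. Were the difference interior, [t] could still be lowered. Comparison arguments below all
    start from this contact point. *)
Lemma cone_touch v z : K° v -> ~ K (- z) ->
  exists2 t : R, 0 < t & K (t *: v - z) /\ ~ K° (t *: v - z).
Proof.
move=> Kv Kz; pose S := [set t : R | K (t *: v - z)].
have Kv' := cone_int_sub Kv.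
have S0 t : S t -> 0 < t.
  move=> St; rewrite ltNge; apply/negP => t0; apply: Kz.
  have -> : - z = t *: v - z + (- t) *: v.
    by rewrite scaleNr addrAC subrr add0r.
  by apply: (order_coneD hK) => //; apply: (order_coneZ hK) => //; rewrite oppr_ge0.
have hS : has_inf S.
  split; last by exists 0 => t /S0/ltW.
  have [c c0 /(_ (- z)) Hc] := cone_unit Kv; exists (c * `|- z|); exact: Hc.
have SE : S (inf S).
  apply: (@cone_arch _ v) => e e0; have [t St tS] := inf_adherent e0 hS.
  have -> : inf S *: v - z + e *: v = t *: v - z + (inf S + e - t) *: v.
    by rewrite scalerBl scalerDl [RHS]addrC addrA subrK [LHS]addrAC.
  apply: (order_coneD hK) => //; apply: (order_coneZ hK) => //.
  by rewrite subr_ge0 ltW.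
exists (inf S); first exact: S0.
split=> // /(cone_int_absorb v)[a a0 Ka].
suff : inf S <= inf S - a by rewrite lerBrDr gerDl leNgt a0.
apply: ge_inf; first exact: hS.2.
by rewrite /S /= scalerBl addrAC.
Qed.

(** The pair [(u, w)] is an eigenvector for [a + i b] on the complexification. On the real plane it
    spans, [A] is a rotation followed by scaling by the modulus [n], while [A v <= s v]. Each
    application of [A] thus improves a bound by [v], uniform over the unit disc of the plane, by the
    factor [s / n < 1], and in the limit the whole disc lies below 0. *)
Lemma eigen_bound (A : {linear B -> B}) v (s a b : R) u w :
  (forall x, K x -> K (A x)) -> K° v -> 0 <= s -> K (s *: v - A v) ->
  A u = a *: u - b *: w -> A w = a *: w + b *: u -> s ^+ 2 < a ^+ 2 + b ^+ 2 ->
  u = 0 /\ w = 0.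
Proof.
move=> Apos Kv s0 Ksv Au Aw sab.
pose n := Num.sqrt (a ^+ 2 + b ^+ 2).
have n2 : n ^+ 2 = a ^+ 2 + b ^+ 2 by rewrite sqr_sqrtr// addr_ge0// sqr_ge0.
have sn : s < n by rewrite -(ltr_pXn2r (n:=2))// ?n2// nnegrE// sqrtr_ge0.
have n0 : 0 < n by exact: le_lt_trans sn.
have [c c0 Hc] := cone_unit Kv.
pose t := c * (`|u| + `|w|).
have H k (x y : R) : x ^+ 2 + y ^+ 2 <= 1 ->
    K ((t * (s / n) ^+ k) *: v - (x *: u + y *: w)).
  elim: k x y => [|k IH] x y xy.
    have xle (r r' : R) : r ^+ 2 + r' ^+ 2 <= 1 -> `|r| <= 1.
      move=> rr; rewrite -(expr_le1 (n:=2))// real_normK ?num_real//.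
      by apply: le_trans rr; rewrite lerDl sqr_ge0.
    have x1 := xle _ _ xy; have y1 : `|y| <= 1 by apply: (xle _ x); rewrite addrC.
    rewrite expr0 mulr1.
    have -> : t *: v - (x *: u + y *: w) =
      (c * `|- (x *: u + y *: w)|) *: v + (- (x *: u + y *: w)) +
      (c * (`|u| + `|w| - `|- (x *: u + y *: w)|)) *: v.
      by rewrite addrAC -scalerDl; congr (_ *: v + _); rewrite /t; ring.
    apply: (order_coneD hK) => //; apply: (order_coneZ hK); last exact: cone_int_sub.
    rewrite mulr_ge0// ?(ltW c0)// subr_ge0 normrN; apply: (le_trans (ler_normD _ _)).
    by rewrite lerD// normrZ ler_piMl.
  (* These are the coordinates of [x + i y] multiplied by [(a + i b) / n], chosen so that [A] maps
     the new combination to [n] times the old one. The disc is preserved. *)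
  pose x' := (a * x - b * y) / n; pose y' := (b * x + a * y) / n.
  have e1 : x' * a + y' * b = n * x.
    rewrite /x' /y'; apply: (mulfI (lt0r_neq0 n0)).
    transitivity ((a ^+ 2 + b ^+ 2) * x); last by rewrite -n2; ring.
    by field; rewrite gt_eqF.
  have e2 : y' * a - x' * b = n * y.
    rewrite /x' /y'; apply: (mulfI (lt0r_neq0 n0)).
    transitivity ((a ^+ 2 + b ^+ 2) * y); last by rewrite -n2; ring.
    by field; rewrite gt_eqF.
  have xy' : x' ^+ 2 + y' ^+ 2 <= 1.
    suff -> : x' ^+ 2 + y' ^+ 2 = x ^+ 2 + y ^+ 2 by [].
    rewrite /x' /y'; apply: (mulfI (lt0r_neq0 (exprn_gt0 2 n0))).
    transitivity ((a ^+ 2 + b ^+ 2) * (x ^+ 2 + y ^+ 2)); last by rewrite n2.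
    by field; rewrite gt_eqF.
  have tk : 0 <= t * (s / n) ^+ k.
    rewrite mulr_ge0// ?exprn_ge0// ?divr_ge0// ?(ltW n0)//.
    by rewrite mulr_ge0 ?addr_ge0// ltW.
  have AE : A (x' *: u + y' *: w) = n *: (x *: u + y *: w).
    rewrite linearD !linearZ /= Au Aw !scalerDr scalerN !scalerA -e1 -e2.
    by rewrite scalerDl scalerBl [_ *: w + _ *: u]addrC addrACA [- _ + _]addrC.
  have -> : (t * (s / n) ^+ k.+1) *: v - (x *: u + y *: w) =
      n^-1 *: (A ((t * (s / n) ^+ k) *: v - (x' *: u + y' *: w)) +
               (t * (s / n) ^+ k) *: (s *: v - A v)).
    set T := t * _ ^+ k; rewrite linearB AE linearZ /= [T *: (_ - _)]scalerBr.
    rewrite [X in n^-1 *: X]addrC addrA subrK scalerBr !scalerA.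
    rewrite mulVf ?gt_eqF// scale1r exprS; congr (_ *: _ - _).
    by rewrite /T; ring.
  apply: (order_coneZ hK); first by rewrite invr_ge0 ltW.
  by apply: (order_coneD hK); [exact/Apos/IH|exact: (order_coneZ hK)].
have q1 : 0 <= s / n < 1.
  by rewrite divr_ge0// ?(ltW n0)//= ltr_pdivrMr// mul1r.
have H1 (x y : R) : x ^+ 2 + y ^+ 2 <= 1 -> K (- (x *: u + y *: w)).
  by move=> xy; apply: (cone_geo q1) => k; apply: H.
split; apply: cone_antisym.
- have := H1 (-1) 0; rewrite scale0r addr0 scaleN1r opprK; apply.
  by rewrite sqrrN expr1n expr0n addr0.
- have := H1 1 0; rewrite scale0r addr0 scale1r; apply.
  by rewrite expr1n expr0n addr0.
- have := H1 0 (-1); rewrite scale0r add0r scaleN1r opprK; apply.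
  by rewrite sqrrN expr1n expr0n add0r.
- have := H1 0 1; rewrite scale0r add0r scale1r; apply.
  by rewrite expr1n expr0n add0r.
Qed.

End OrderCone.

(** * Compact linear operators *)

(** Asking for one compact set that contains the image of each ball lets [compact_refine] apply
    directly. *)
Definition compact_linear {R : realType} {E : normedModType R} (T : E -> E) :=
  forall M : R, exists2 C : set E, compact C & forall x, `|x| <= M -> C (T x).

Lemma compact_on_linear {R : realType} {E : normedModType R} (T : E -> E) :
  compact_on setT T -> compact_linear T.
Proof.
move=> cT M; exists (closure (T @` [set x | `|x| <= M])).
  rewrite -precompactE; apply: cT => //.
  exists M; split; first exact: num_real.
  by move=> N MN x /= /le_trans; apply; exact: ltW.
by move=> x xM; apply: subset_closure; exists x.
Qed.

Section Fredholm.
Context {R : realType} {E : normedModType R}.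
Variables (T : E -> E) (Tlin : linear T) (Tcont : continuous T).
Hypothesis Tcpt : compact_linear T.
Hypothesis Tinj : forall x, T x = x -> x = 0.

Let A x := x - T x.

Let T0 : T 0 = 0.
Proof.
have := Tlin (-1) 0 0; rewrite scaler0 addr0 scaleN1r => ->.
by rewrite addNr.
Qed.
Let TZ a x : T (a *: x) = a *: T x.
Proof. by rewrite -[a *: x]addr0 Tlin T0 addr0. Qed.
Let TB x y : T (x - y) = T x - T y.
Proof. by rewrite addrC -scaleN1r Tlin scaleN1r addrC. Qed.
Let AZ a x : A (a *: x) = a *: A x.
Proof. by rewrite /A TZ scalerBr. Qed.
Let AB x y : A (x - y) = A x - A y.
Proof. by rewrite /A TB !opprB addrACA [RHS]addrACA [- y + _]addrC. Qed.

(** Otherwise there are unit vectors with [x - T x] tending to 0. Compactness makes [T x] converge,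
    hence also [x], and the limit is a fixed vector of norm 1. *)
Lemma fredholm_lower_bound :
  exists2 c : R, 0 < c & forall x, c * `|x| <= `|x - T x|.
Proof.
apply: contrapT => /forall2NP H.
have /choice[x Hx] : forall n : nat, exists x, `|x| = 1 /\ `|A x| < n.+1%:R^-1.
  move=> n; have [|/existsNP[x /negP]] := H (n.+1%:R^-1).
    by move=> []; rewrite invr_gt0.
  rewrite -ltNge => xA.
  have x0 : 0 < `|x|.
    rewrite normr_gt0; apply: contraTneq xA => ->.
    by rewrite T0 subr0 normr0 mulr0 ltxx.
  exists (`|x|^-1 *: x); rewrite AZ !normrZ !ger0_norm ?invr_ge0//.
  by rewrite mulVf ?gt_eqF// mulrC ltr_pdivrMr.
have [C cC HC] := Tcpt 1.
have [|G [GP nG [l _ Gl]]] := @compact_refine _ _ \oo _ C (T \o x) cC.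
  by apply: nearW => n; apply: HC; rewrite (Hx n).1.
have Ax0 : (A \o x) @ G --> (0 : E).
  apply: (cvg_trans (G := (A \o x) @ \oo)); first by move=> U /nG.
  apply/cvgrPdist_lt => e e0; near=> n; rewrite sub0r normrN.
  apply: (lt_trans (Hx n).2); near: n.
  exact: near_infty_natSinv_lt (PosNum e0).
have xl : x @ G --> l.
  rewrite -[l]add0r (_ : x = fun n => A (x n) + T (x n)).
    exact: cvgD.
  by apply/funext => n; rewrite subrK.
have Tl : T l = l.
  apply: (norm_cvg_unique _ Gl).
  by apply: continuous_cvg => //; exact: Tcont.
suff : `|l| = 1 by rewrite (Tinj Tl) normr0 => /eqP; rewrite eq_sym oner_eq0.
apply: (norm_cvg_unique (cvg_norm xl)).
rewrite (_ : (fun _ => _) = fun=> 1); first exact: cvg_cst.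
by apply/funext => n; rewrite (Hx n).1.
Unshelve. all: by end_near. Qed.

(** Riesz's argument. A point [y] outside the closed range of [A] makes the ranges of the iterates
    of [A] strictly decreasing. Almost orthogonal unit vectors chosen in them have images under [T]
    that stay 1/2 apart, against compactness. *)
Lemma fredholm_surjective y : exists x, x - T x = y.
Proof.
have [c c0 Hc] := fredholm_lower_bound.
apply: contrapT => /forallNP Hy.
(* The range is closed: preimages of a sequence approaching [y] are bounded by the lower bound, so a
   limit of their images under [T] yields a preimage of [y]. *)
have [d d0 Hd] : exists2 d : R, 0 < d & forall e, d <= `|y - A e|.
  apply: contrapT => /forall2NP H.
  have /choice[x Hx] : forall n : nat, exists x, `|y - A x| < n.+1%:R^-1.
    move=> n; have [|/existsNP[x /negP]] := H (n.+1%:R^-1).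
      by move=> []; rewrite invr_gt0.
    by rewrite -ltNge; exists x.
  have [C cC HC] := Tcpt ((`|y| + 1) / c).
  have [|G [GP nG [l _ Gl]]] := @compact_refine _ _ \oo _ C (T \o x) cC.
    apply: nearW => n; apply: HC; rewrite ler_pdivlMr// mulrC.
    apply: (le_trans (Hc _)); rewrite -lerBlDl; apply: (le_trans (lerB_dist _ _)).
    rewrite distrC; apply: (le_trans (ltW (Hx n))).
    by rewrite invf_le1 ?ler1n.
  have Axy : (A \o x) @ G --> y.
    apply: (cvg_trans (G := (A \o x) @ \oo)); first by move=> U /nG.
    apply/cvgrPdist_lt => e e0; near=> n.
    apply: (lt_trans (Hx n)); near: n.
    exact: near_infty_natSinv_lt (PosNum e0).
  have xl : x @ G --> y + l.
    rewrite (_ : x = fun n => A (x n) + T (x n)).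
      exact: cvgD.
    by apply/funext => n; rewrite subrK.
  have Tl : T (y + l) = l.
    apply: (norm_cvg_unique _ Gl).
    by apply: continuous_cvg => //; exact: Tcont.
  by apply: (Hy (y + l)); rewrite Tl addrK.
have AnB n u v : iter n A (u - v) = iter n A u - iter n A v.
  by elim: n => //= n ->; rewrite AB.
have AnZ n a u : iter n A (a *: u) = a *: iter n A u.
  by elim: n => //= n ->; rewrite AZ.
have Anc n u : c ^+ n * `|u| <= `|iter n A u|.
  elim: n => [|n IH]; first by rewrite mul1r.
  rewrite exprS -mulrA iterS; apply: (le_trans _ (Hc _)).
  by rewrite ler_pM2l.
(* Riesz's lemma for the range of the iterate [n.+1] inside that of the iterate [n]. The distance
   [inf D] is positive since the iterate of order [n] is bounded below by [c ^+ n]. A vector at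
   distance less than twice [inf D] gives the constant 1/2 after normalization. *)
have /choice[x Hx] : forall n, exists x, [/\ `|x| = 1,
    exists w, x = iter n A w & forall e, 2^-1 <= `|x - iter n.+1 A e|].
  move=> n; pose D := [set `|iter n A y - iter n.+1 A e| | e in setT].
  have Dlb : lbound D (c ^+ n * d).
    move=> _ [e _ <-]; rewrite iterSr -AnB; apply: (le_trans _ (Anc _ _)).
    by rewrite ler_pM2l ?exprn_gt0.
  have D0 : D !=set0 by exists `|iter n A y - iter n.+1 A 0|, 0.
  have infD : 0 < inf D.
    by apply: (lt_le_trans _ (lb_le_inf D0 Dlb)); rewrite mulr_gt0 ?exprn_gt0.
  have hD : has_inf D by split => //; exists (c ^+ n * d).
  have [_ [e _ <-] De] := inf_adherent infD hD.
  have Dle e' : inf D <= `|iter n A y - iter n.+1 A e'|.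
    by apply: ge_inf; [exact: hD.2|exists e'].
  set z := iter n A y - iter n.+1 A e in De *.
  have z0 : 0 < `|z| by exact: lt_le_trans (Dle e).
  exists (`|z|^-1 *: z); split.
  - by rewrite normrZ ger0_norm ?invr_ge0// mulVf// gt_eqF.
  - by exists (`|z|^-1 *: (y - A e)); rewrite AnZ AnB -iterSr.
  - move=> e'; have -> : `|z|^-1 *: z - iter n.+1 A e' =
        `|z|^-1 *: (iter n A y - iter n.+1 A (e - (- `|z|) *: e')).
      rewrite [iter n.+1 A (_ - _)]AnB AnZ scaleNr opprK.
      rewrite [- (_ + _ *: _)]opprD addrA -/z.
      by rewrite [RHS]scalerBr scalerA mulVf ?gt_eqF// scale1r.
    rewrite normrZ ger0_norm ?invr_ge0// ler_pdivlMl//.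
    apply: (le_trans _ (Dle _)); rewrite ler_pdivrMr// mulr_natr mulr2n.
    exact: ltW.
(* With [T = 1 - A], this difference is [x n] minus [A (x n) - A (x m) + x m], and the latter lies
   in the range of the iterate [n.+1]. *)
have Tx n m : (n < m)%N -> 2^-1 <= `|T (x n) - T (x m)|.
  move=> nm; have [_ [w xw] Hn] := Hx n; have [_ [w' xw'] _] := Hx m.
  pose k := (m - n).-1.
  have mE : m = (n.+1 + k)%N by rewrite /k addSnnS prednK ?subn_gt0// subnKC// ltnW.
  have := Hn (w - (iter k.+1 A w' - iter k A w')); congr (_ <= `|_|).
  have e1 : iter n.+1 A w = A (x n) by rewrite iterS -xw.
  have e2 : iter n.+1 A (iter k.+1 A w') = A (x m).
    by rewrite -iterD addnS -mE iterS -xw'.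
  have e3 : iter n.+1 A (iter k A w') = x m by rewrite -iterD -mE -xw'.
  have TE u : T u = u - A u by rewrite /A opprB addrC subrK.
  rewrite (AnB n.+1 w) (AnB n.+1 (iter k.+1 A w')) e1 e2 e3 !TE.
  by move: (A (x n)) (A (x m)) => a b; rewrite !opprB [b - _ - a]addrC addrA.
have [C cC HC] := Tcpt 1.
have [|G [GP nG [l _ Gl]]] := @compact_refine _ _ \oo _ C (T \o x) cC.
  by apply: nearW => n; apply: HC; have [-> _ _] := Hx n.
have G4 : \forall n \near G, `|l - T (x n)| < 4^-1.
  by move/cvgrPdist_lt : Gl; apply; rewrite invr_gt0.
have [n Hn] := filter_ex G4.
have [m [nm Hm]] : exists m, (n < m)%N /\ `|l - T (x m)| < 4^-1.
  by apply: (@filter_ex _ G); apply: filterI => //; apply: nG; exact: nbhs_infty_gt.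
have := Tx _ _ nm; apply/negP; rewrite -ltNge.
have -> : T (x n) - T (x m) = (l - T (x m)) - (l - T (x n)).
  by rewrite opprB [RHS]addrC addrA subrK.
apply: (le_lt_trans (ler_normB _ _)); apply: (lt_le_trans (ltrD Hm Hn)).
by rewrite le_eqVlt; apply/orP; left; apply/eqP; field.
Unshelve. all: by end_near. Qed.

Lemma fredholm : exists S : E -> E,
  [/\ continuous S, cancel (fun x => x - T x) S & cancel S (fun x => x - T x)].
Proof.
have [c c0 Hc] := fredholm_lower_bound.
have [S HS] := choice fredholm_surjective.
have SL y y' : c * `|S y - S y'| <= `|y - y'|.
  by rewrite -[in leRHS](HS y) -[in leRHS](HS y') -AB; exact: Hc.
exists S; split => //.
- move=> y; apply/cvgrPdist_le => e e0.
  near=> z; rewrite -(ler_pM2l c0); apply: (le_trans (SL _ _)).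
  near: z; apply: cvgr_dist_le; first exact: cvg_id.
  exact: mulr_gt0.
- move=> x; have e : A (S (A x) - x) = 0 by rewrite AB {1}/A HS subrr.
  apply/eqP; rewrite -subr_eq0; apply/eqP/Tinj/esym/eqP.
  by rewrite -subr_eq0; exact/eqP.
Unshelve. all: by end_near. Qed.

End Fredholm.

(** * Nonzero spectral values of a compact operator *)

Section Spectrum.
Context {R : realType} {B : normedModType R}.
Implicit Types L : {linear B -> B}.

(** Real 2 by 2 matrices acting on the complexification; multiplication by [a + i b] is the matrix
    with rows [a, - b] and [b, a]. *)
Let act2 (p q r s : R) (z : B * B) : B * B :=
  (p *: z.1 + q *: z.2, r *: z.1 + s *: z.2).

Let act2_comp p q r s p' q' r' s' z :
  act2 p q r s (act2 p' q' r' s' z) =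
  act2 (p * p' + q * r') (p * q' + q * s') (r * p' + s * r') (r * q' + s * s') z.
Proof. by congr pair; rewrite /= !scalerDr !scalerA addrACA -!scalerDl. Qed.

Let act2_id p q r s z : p = 1 -> q = 0 -> r = 0 -> s = 1 -> act2 p q r s z = z.
Proof.
by case: z => u w -> -> -> ->; rewrite /act2 /= !scale1r !scale0r addr0 add0r.
Qed.

Let act2_linear p q r s : linear (act2 p q r s).
Proof.
move=> c x y; congr pair => /=; rewrite !scalerDr !scalerA addrACA.
  by rewrite (mulrC p) (mulrC q).
by rewrite (mulrC r) (mulrC s).
Qed.

Let act2_continuous p q r s : continuous (act2 p q r s).
Proof.
move=> z; apply: cvg_pair.
  by apply: cvgD; apply: cvgZr; [exact: cvg_fst|exact: cvg_snd].
by apply: cvgD; apply: cvgZr; [exact: cvg_fst|exact: cvg_snd].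
Qed.

(** By contraposition. Dividing by [- lambda] turns the shifted operator into [1 - T], where [T] is
    [L] divided by [lambda], still compact. Without eigenvectors [T] has no nonzero fixed vector,
    and the Fredholm alternative provides a continuous inverse. *)
Lemma spectrum_eigenvector L (lambda : R[i]) : continuous L ->
  compact_linear L -> spectrum L lambda -> lambda != 0 ->
  exists u w : B, [/\ ~ (u = 0 /\ w = 0),
    L u = complex.Re lambda *: u - complex.Im lambda *: w &
    L w = complex.Re lambda *: w + complex.Im lambda *: u].
Proof.
case: lambda => a b; rewrite eq_complex negb_and /= => Lcont Lcpt + ab.
apply: contraPP => /forallNP H; apply.
pose n := a ^+ 2 + b ^+ 2.
have n0 : n != 0.
  by rewrite paddr_eq0 ?sqr_ge0// !sqrf_eq0 negb_and.
pose J := act2 (a / n) (b / n) (- b / n) (a / n).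
pose Jl := act2 a (- b) b a.
have JK : cancel Jl J.
  by move=> z; rewrite /J /Jl act2_comp; apply: act2_id; rewrite /n; field.
have JlK : cancel J Jl.
  by move=> z; rewrite /J /Jl act2_comp; apply: act2_id; rewrite /n; field.
pose LL (z : B * B) := (L z.1, L z.2).
have LLcont : continuous LL.
  move=> z; apply: cvg_pair.
    by apply: continuous_cvg; [exact: Lcont|exact: cvg_fst].
  by apply: continuous_cvg; [exact: Lcont|exact: cvg_snd].
pose T := J \o LL.
have Tlin : linear T.
  move=> c x y; rewrite /T /= -act2_linear; congr (J _).
  by congr pair => /=; rewrite linearP.
have Tcont : continuous T.
  by move=> z; apply: continuous_comp; [exact: LLcont|exact: act2_continuous].
have Tcpt : compact_linear T.
  move=> M; have [C cC HC] := Lcpt M.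
  exists (J @` (C `*` C)).
    apply: continuous_compact; last exact: compact_setX.
    by apply: continuous_subspaceT; exact: act2_continuous.
  move=> z zM; exists (LL z) => //; split; apply: HC; apply: le_trans zM.
    by rewrite prod_normE le_max lexx.
  by rewrite prod_normE le_max lexx orbT.
have shiftE z : complex_shift L (a +i* b)%C z = LL z - Jl z.
  transitivity (L z.1 - (a *: z.1 + - b *: z.2), L z.2 - (b *: z.1 + a *: z.2)).
    by rewrite scaleNr [b *: _ + _]addrC.
  by [].
have shiftJ z : J (- complex_shift L (a +i* b)%C z) = z - T z.
  have Jlin : linear J by exact: act2_linear.
  by rewrite shiftE opprB addrC -scaleN1r Jlin JK scaleN1r addrC.
have Tinj z : T z = z -> z = 0.
  move=> Tz; have E : LL z = Jl z by rewrite -{2}Tz /T /= JlK.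
  apply: contrapT => z0; apply: (H z.1); exists z.2; split.
  - by move=> [z1 z2]; apply: z0; case: (z) z1 z2 => /= ? ? -> ->.
  - by have /(congr1 fst)/= -> := E; rewrite scaleNr.
  - by have /(congr1 snd)/= -> := E; rewrite addrC.
have [S [Scont SK KS]] := fredholm Tlin Tcont Tcpt Tinj.
exists (fun z => S (J (- z))); split.
- move=> z; apply: continuous_comp; last exact: Scont.
  by apply: continuous_comp; [exact: opp_continuous|exact: act2_continuous].
- by move=> z; rewrite shiftJ SK.
- move=> z; apply: oppr_inj; apply: (can_inj JlK); rewrite -/J.
  by rewrite shiftJ KS.
Qed.

End Spectrum.

(** * The Krein-Rutman theorem *)

Section KreinRutman.
Context {R : realType} {B : normedModType R}.
Variables (K : set B) (hK : order_cone K).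
Variables (P : {linear B -> B}) (Pspos : strongly_positive K P).

Lemma strongly_positive_int x : K x -> x <> 0 -> K° (P x).
Proof.
move=> Kx x0; have : cone_ll K 0 (P x).
  by apply: Pspos; split; [rewrite /cone_le subr0|exact: nesym].
by rewrite /cone_ll subr0.
Qed.

Lemma strongly_positive_pos x : K x -> K (P x).
Proof.
move=> Kx; have [->|/eqP x0] := eqVneq x 0.
  by rewrite linear0; exact: order_cone0 hK.
by apply: cone_int_sub; exact: strongly_positive_int.
Qed.

(** At the contact point [t v - w] is again an eigenvector for [r]. If it were nonzero, [P] would
    send it to the interior, and division by [r > 0] would place the contact point itself there. *)
Lemma principal_eigenvector_unique v w (r : R) : K° v -> P v = r *: v ->
  K w -> w <> 0 -> P w = r *: w -> exists2 s : R, 0 < s & w = s *: v.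
Proof.
move=> Kv Pv Kw w0 Pw.
have [|t t0 [Kt nKt]] := cone_touch hK Kv (z := w).
  by move=> KNw; apply: w0; exact: (cone_antisym hK).
exists t => //; apply: contrapT => wt.
have /(strongly_positive_int Kt) : t *: v - w <> 0.
  by move=> /eqP; rewrite subr_eq0 => /eqP/esym.
have -> : P (t *: v - w) = r *: (t *: v - w).
  by rewrite linearB linearZ /= Pv Pw scalerBr !scalerA mulrC.
have r0 : 0 < r.
  have : K° (r *: v).
    by rewrite -Pv; apply: strongly_positive_int; [exact: cone_int_sub|
      move=> v0; apply: (cone_int_neq0 hK); rewrite -v0].
  rewrite ltNge => Krv; apply/negP => r0; apply: (cone_int_notN hK Krv).
  by rewrite -scaleNr; apply: (order_coneZ hK); [rewrite oppr_ge0|exact: cone_int_sub].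
move=> /(cone_intZ hK (_ : 0 < r^-1)); rewrite invr_gt0 => /(_ r0).
by rewrite scalerA mulVf ?gt_eqF// scale1r.
Qed.

(** At the contact point, [P (t v - w) = t r v - w] is interior. If [r <= 1], adding the nonnegative
    multiple [t (1 - r) v] shows that [t v - w] is interior as well. That [w] is outside the cone
    keeps [t v - w] from vanishing. *)
Lemma principal_eigenvalue_gt1 v w (r : R) : K° v -> P v = r *: v ->
  P w = w -> ~ K w -> ~ K (- w) -> 1 < r.
Proof.
move=> Kv Pv Pw Kw KNw.
have [t t0 [Kt nKt]] := cone_touch hK Kv KNw.
rewrite ltNge; apply/negP => r1; apply: nKt.
have := strongly_positive_int Kt; rewrite linearB linearZ /= Pv Pw => H.
have -> : t *: v - w = t *: (r *: v) - w + (t * (1 - r)) *: v.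
  by rewrite addrAC scalerA -scalerDl; congr (_ *: v - _); ring.
apply: (cone_intDl hK).
  apply: H => /eqP; rewrite subr_eq0 => /eqP tw; apply: Kw; rewrite -tw.
  by apply: (order_coneZ hK); [exact: ltW|exact: cone_int_sub].
apply: (order_coneZ hK); last exact: cone_int_sub.
by rewrite mulr_ge0 ?subr_ge0// ltW.
Qed.

Hypothesis Pcont : continuous P.
Hypothesis Pcpt : compact_linear P.

(** Supersolution constants; their infimum is the upper Collatz-Wielandt number of [P]. *)
Let supers (mu : R) := exists2 x, K° x & K (mu *: x - P x).

(** By [eigen_bound], [mu] is not an eigenvalue, so the Fredholm alternative solves the equation. If
    the solution [y] were not positive, the contact point [t x + y] would be, up to the factor [mu],
    a sum of positive terms and the interior vector [u]. *)
Lemma supersolution_solve (mu mu' : R) u : 0 < mu' -> mu' < mu -> supers mu' ->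
  K° u -> exists2 y, K y & mu *: y - P y = u.
Proof.
move=> mu'0 mumu' [x Kx Kmu'] Ku.
have mu0 : 0 < mu by exact: lt_trans mumu'.
pose T z := mu^-1 *: P z.
have Tlin : linear T.
  by move=> a y z; rewrite /T linearP scalerDr !scalerA mulrC.
have Tcont : continuous T by move=> z; apply: cvgZr; exact: Pcont.
have Tcpt : compact_linear T.
  move=> M; have [C cC HC] := Pcpt M; exists ((fun z => mu^-1 *: z) @` C).
    apply: continuous_compact cC; apply: continuous_subspaceT => z.
    by apply: cvgZr; exact: cvg_id.
  by move=> z /HC Cz; exists (P z).
have Tinj z : T z = z -> z = 0.
  move=> Tz; have Pz : P z = mu *: z.
    by rewrite -{2}Tz /T scalerA divff ?gt_eqF// scale1r.
  have [|||//] := eigen_bound hK (A := P) (a := mu) (b := 0) (u := z) (w := 0)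
    strongly_positive_pos Kx (ltW mu'0) Kmu'.
  - by rewrite Pz scaler0 subr0.
  - by rewrite linear0 scaler0 scale0r addr0.
  - by rewrite expr0n addr0 ltr_pXn2r// nnegrE ltW.
have [y yT] := fredholm_surjective Tlin Tcont Tcpt Tinj (mu^-1 *: u).
have yE : mu *: y - P y = u.
  have := congr1 (fun z => mu *: z) yT.
  by rewrite /= scalerBr /T !scalerA divff ?gt_eqF// !scale1r.
exists y => //; apply: contrapT => Ky.
have [|t t0 [Kt nKt]] := cone_touch hK Kx (z := - y); first by rewrite opprK.
apply: nKt; move: Kt; rewrite opprK => Kt.
have -> : t *: x + y = mu^-1 *: (P (t *: x + y) + (t *: (mu *: x - P x) + u)).
  have Pxy : P (t *: x + y) = t *: P x + P y by rewrite linearP.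
  rewrite -[in RHS]yE Pxy [t *: (_ - _)]scalerBr addrACA !subrKC.
  by rewrite scalerDr !scalerA mulVf ?gt_eqF// scale1r mulrAC mulVf ?gt_eqF// mul1r.
apply: (cone_intZ hK); first by rewrite invr_gt0.
rewrite [P _ + _]addrC -addrA; rewrite [_ + (u + _)]addrC.
apply: (cone_intDl hK); last first.
  apply: (order_coneZ hK); first exact: ltW.
  have -> : mu *: x - P x = (mu' *: x - P x) + (mu - mu') *: x.
    by rewrite addrAC -scalerDl subrKC.
  apply: (order_coneD hK) => //; apply: (order_coneZ hK); last exact: cone_int_sub.
  by rewrite subr_ge0 ltW.
by apply: (cone_intDl hK) => //; exact: strongly_positive_pos.
Qed.

(** Let [m] be the infimum of the supersolution constants and solve [mu y - P y = u] for [mu]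
    decreasing to [m]. Normalized solutions converge either to an eigenvector for [m], or to an
    interior point that is a supersolution for a constant below [m]. *)
Lemma krein_rutman : K° !=set0 ->
  exists2 r : R, 0 < r & exists2 v, K° v & P v = r *: v.
Proof.
move=> [u Ku].
have u0 : u <> 0 by move=> u0; apply: (cone_int_neq0 hK); rewrite -u0.
have KPu := strongly_positive_int (cone_int_sub Ku) u0.
suff [r r0 [x Kx [x0 Px]]] : exists2 r : R, 0 < r &
    exists2 x, K x & x <> 0 /\ P x = r *: x.
  exists r => //; exists x => //.
  have := cone_intZ hK (_ : 0 < r^-1) (strongly_positive_int Kx x0).
  by rewrite invr_gt0 => /(_ r0); rewrite Px scalerA mulVf ?gt_eqF// scale1r.
apply: contrapT => noev.
pose M := [set mu : R | 0 < mu /\ supers mu].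
have [a a0 Ka] := cone_int_absorb u KPu.
(* Here [a u <= P u]. If [P x <= mu x] with [mu < a], iterating [u <= P u / a] from a bound
   [u <= t x] gives [u <= t (mu / a) ^ n x] for all [n], hence [u <= 0]. *)
have Mlb : lbound M a.
  move=> mu [mu0 [x Kx Kmu]]; rewrite leNgt; apply/negP => mua.
  apply: (cone_int_notN hK Ku).
  have [c c0 Hc] := cone_unit hK Kx.
  apply: (@cone_geo _ _ _ hK x u (c * `|- u|) (mu / a)).
    by rewrite divr_ge0 ?(ltW a0) ?(ltW mu0)//= ltr_pdivrMr// mul1r.
  elim=> [|n IH]; first by rewrite mulr1; exact: Hc.
  set t := c * _; set T := t * (mu / a) ^+ n in IH.
  have T0 : 0 <= T.
    rewrite mulr_ge0// ?exprn_ge0//; first by rewrite mulr_ge0// ltW.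
    by rewrite divr_ge0// ltW.
  have -> : (t * (mu / a) ^+ n.+1) *: x - u =
     a^-1 *: (P (T *: x - u) + T *: (mu *: x - P x) + (P u - a *: u)).
    have telescope (p q r w : B) : (p - q) + (r - p) + (q - w) = r - w.
      by rewrite [p - q + _]addrC !addrA !subrK.
    rewrite linearB linearZ /= [T *: (_ - _)]scalerBr telescope scalerBr !scalerA.
    rewrite mulVf ?gt_eqF// scale1r exprS; congr (_ *: _ - _).
    by rewrite /T; ring.
  apply: (order_coneZ hK); first by rewrite invr_ge0 ltW.
  apply: (order_coneD hK) => //; apply: (order_coneD hK).
    exact: strongly_positive_pos.
  exact: (order_coneZ hK).
have M0 : M !=set0.
  have [c c0 Hc] := cone_unit hK Ku; exists (c * `|- P u| + 1); split.
    by rewrite ltr_wpDl// mulr_ge0// ltW.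
  exists u => //; rewrite scalerDl scale1r addrAC.
  by apply: (order_coneD hK) => //; exact: cone_int_sub.
have hM : has_inf M by split => //; exists a.
set m := inf M.
have m0 : 0 < m by exact: lt_le_trans (lb_le_inf M0 Mlb).
have mn (n : nat) : m < m + n.+1%:R^-1 by rewrite ltrDl invr_gt0.
have /choice[y Hy] : forall n : nat, exists y,
    K y /\ (m + n.+1%:R^-1) *: y - P y = u.
  move=> n; have e0 : 0 < (n.+1%:R^-1 : R) by rewrite invr_gt0.
  have [mu' [mu'0 Hmu'] mu'n] := inf_adherent e0 hM.
  by have [y] := supersolution_solve mu'0 mu'n Hmu' Ku; exists y.
(* The extra 1 treats bounded and unbounded solutions together: the limit [k] of [s] is 0 when they
   blow up along the filter, the limit of [z] then having norm 1, and is positive otherwise. *)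
pose s n : R := (1 + `|y n|)^-1.
have y1 n : 0 < 1 + `|y n| by rewrite ltr_pwDl.
pose z n := s n *: y n.
have z1 n : `|z n| = 1 - s n.
  rewrite normrZ ger0_norm ?invr_ge0 ?ltW// /s.
  by have := y1 n => /lt0r_neq0 h; field.
have s01 n : 0 <= s n <= 1.
  by rewrite invr_ge0 ltW//= invf_le1// lerDl.
have [C cC HC] := Pcpt 1.
have [|G1 [G1P nG1 [l _ Gl]]] := @compact_refine _ _ \oo _ C (P \o z) cC.
  apply: nearW => n; apply: HC; rewrite z1 gerBl.
  by case/andP: (s01 n).
have [|G [GP G1G [k /= k01 Gk]]] :=
    @compact_refine _ _ G1 _ _ s (@segment_compact R 0 1).
  by apply: nearW => n; rewrite /= in_itv /= s01.
have {}Gl : (P \o z) @ G --> l by move=> U /Gl/G1G.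
have nG : \oo `<=` G by move=> U /nG1/G1G.
have Gm : (fun n : nat => m + n.+1%:R^-1) @ G --> m.
  apply: (cvg_trans (G := (fun n : nat => m + n.+1%:R^-1) @ \oo)); first by move=> U /nG.
  have : (fun n : nat => m + n.+1%:R^-1) @ \oo --> m + 0.
    by apply: cvgD; [exact: cvg_cst|exact: cvg_harmonic].
  by rewrite addr0.
have zE n : z n = (m + n.+1%:R^-1)^-1 *: (P (z n) + s n *: u).
  rewrite -[in RHS](Hy n).2 /z linearZ /= [s n *: (_ - _)]scalerBr subrKC !scalerA.
  rewrite mulrAC mulVf ?mul1r//; apply/lt0r_neq0.
  exact: lt_trans (mn n).
pose zl := m^-1 *: (l + k *: u).
have Gz : z @ G --> zl.
  rewrite (_ : z = fun n => (m + n.+1%:R^-1)^-1 *: (P (z n) + s n *: u)).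
    apply: cvgZ; first by apply: cvgV => //; rewrite gt_eqF.
    by apply: cvgD => //; exact: cvgZl.
  by apply/funext => n; exact: zE.
have Pzl : P zl = l.
  by apply: (norm_cvg_unique _ Gl); apply: continuous_cvg => //; exact: Pcont.
have mzl : m *: zl - P zl = k *: u.
  by rewrite Pzl /zl scalerA divff ?gt_eqF// scale1r addrC addKr.
have Kzl : K zl.
  apply: (cone_lim hK _ Gz); apply: nearW => n.
  apply: (order_coneZ hK); last exact: (Hy n).1.
  by case/andP: (s01 n).
have nzl : `|zl| = 1 - k.
  apply: (norm_cvg_unique (cvg_norm Gz)).
  rewrite (_ : (fun _ => _) = fun n => 1 - s n); last exact/funext.
  by apply: cvgB => //; exact: cvg_cst.
move: k01; rewrite in_itv /= => /andP[]; rewrite le_eqVlt => /orP[/eqP k0 _|k0 _].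
  apply: noev; exists m => //; exists zl => //; split.
    by move=> zl0; move/eqP: nzl; rewrite zl0 normr0 -k0 subr0 eq_sym oner_eq0.
  by apply/eqP; rewrite eq_sym -subr_eq0 mzl -k0 scale0r.
have Kzl' : K° zl.
  have -> : zl = m^-1 *: (k *: u + P zl).
    by rewrite -mzl subrK scalerA mulVf ?gt_eqF// scale1r.
  apply: (cone_intZ hK); first by rewrite invr_gt0.
  by apply: (cone_intDl hK); [exact: (cone_intZ hK)|exact: strongly_positive_pos].
(* The slack [k u] dominates a small multiple of [zl], so the constant [m] can be lowered; the
   minimum with [m / 2] keeps it positive. *)
have [b b0 Kb] := cone_int_absorb zl (cone_intZ hK k0 Ku).
pose e := Num.min b (m / 2).
have e0 : 0 < e by rewrite lt_min b0 divr_gt0.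
have em : e < m.
  by rewrite gt_min; apply/orP; right; rewrite ltr_pdivrMr// mulr_natr mulr2n ltrDl.
have : M (m - e).
  split; first by rewrite subr_gt0.
  exists zl => //; rewrite scalerBl addrAC mzl.
  have -> : k *: u - e *: zl = k *: u - b *: zl + (b - e) *: zl.
    by rewrite scalerBl addrA subrK.
  apply: (order_coneD hK) => //; apply: (order_coneZ hK) => //.
  by rewrite subr_ge0 ge_min lexx.
move/(ge_inf hM.2); rewrite -/m => /=.
by rewrite leNgt ltrBlDr ltrDl e0.
Qed.

End KreinRutman.

(** * Differential calculus on subsets *)

Section SpectralRadius.
Context {R : realType} {B : normedModType R}.
Variables (K : set B) (hK : order_cone K).

(** A spectral value of modulus above [s] is nonzero, hence an eigenvalue by compactness, and
    [eigen_bound] makes its eigenvector vanish. *)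
Lemma spectral_radius_le (A : {linear B -> B}) v (s : R) : continuous A ->
  compact_linear A -> (forall x, K x -> K (A x)) -> K° v -> 0 <= s ->
  K (s *: v - A v) -> (spectral_radius A <= s%:E)%E.
Proof.
move=> Acont Acpt Apos Kv s0 Ksv; apply: ge_ereal_sup => _ [[a b] sab <-].
rewrite lee_fin leNgt; apply/negP => /= sn.
have ab0 : (a +i* b)%C != 0.
  rewrite eq_complex /= negb_and; apply: contraTT sn => /norP[].
  by rewrite !negbK => /eqP-> /eqP->; rewrite expr0n addr0 sqrtr0 -leNgt.
have [u [w [uw Au Aw]]] := spectrum_eigenvector Acont Acpt sab ab0.
apply: uw; apply: (eigen_bound hK Apos Kv s0 Ksv Au Aw) => /=.
have := sn; rewrite -(ltr_pXn2r (n := 2)) ?nnegrE ?sqrtr_ge0//.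
by rewrite sqr_sqrtr// addr_ge0// sqr_ge0.
Qed.

End SpectralRadius.

(** Induction along the half-line: at the infimum of the failures the property holds by the
    left-limit clause, and the right-extension clause then excludes failures just above it. *)
Lemma real_induction {R : realType} (P : R -> Prop) : P 0 ->
  (forall l, 0 <= l -> P l ->
    exists2 d, 0 < d & forall h, 0 < h <= d -> P (l + h)) ->
  (forall l, 0 < l -> (forall k, 0 <= k < l -> P k) -> P l) ->
  forall l, 0 <= l -> P l.
Proof.
move=> P0 Pr Pl l l0; apply: contrapT => nPl.
pose N := [set k : R | 0 <= k /\ ~ P k].
have hN : has_inf N by split; [exists l|exists 0 => k []].
have m0 : 0 <= inf N by apply: lb_le_inf; [exists l|move=> k []].
have Pm k : 0 <= k < inf N -> P k.
  move=> /andP[k0 kN]; apply: contrapT => nPk; move: kN; rewrite ltNge.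
  by move/negP; apply; exact: ge_inf hN.2 _ (conj k0 nPk).
have PN : P (inf N).
  by move: m0; rewrite le_eqVlt => /orP[/eqP <- //|m0]; exact: Pl.
have [d d0 Hd] := Pr _ m0 PN.
have [k [k0 nPk] kN] := inf_adherent d0 hN; have Nk := ge_inf hN.2 (conj k0 nPk : N k).
apply: nPk; move: Nk; rewrite le_eqVlt => /orP[/eqP <- //|Nk].
rewrite -[k](subrK (inf N)) addrC; apply: Hd.
by rewrite subr_gt0 Nk lerBlDl ltW.
Qed.

Section Calculus.
Context {R : realType} {B : normedModType R}.
Implicit Types (X K : set B) (f g : B -> B) (L M : {linear B -> B}).

(** A mean value inequality in which the admissible step [d] may depend on the point; the bound
    [M * l] on the increment from 0 propagates by [real_induction]. *)
Lemma local_lipschitz (h : R -> B) (M : R) : 0 <= M ->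
  (forall s, 0 <= s <= 1 -> exists2 d, 0 < d & forall t, 0 <= t <= 1 ->
    `|t - s| <= d -> `|h t - h s| <= M * `|t - s|) ->
  `|h 1 - h 0| <= M.
Proof.
move=> M0 H.
suff : forall l, 0 <= l -> l <= 1 -> `|h l - h 0| <= M * l.
  by move=> /(_ 1 ler01 (lexx _)); rewrite mulr1.
apply: real_induction.
- by move=> _; rewrite subrr normr0 mulr0.
- move=> l l0 Pl; have [l1|l1] := leP l 1; last first.
    exists 1 => // k /andP[k0 _] lk; suff : l <= 1 by rewrite leNgt l1.
    by apply: le_trans lk; rewrite lerDl ltW.
  have [d d0 Hd] := H l (introT andP (conj l0 l1)).
  exists d => // k /andP[k0 kd] lk.
  rewrite -(subrK (h l) (h (l + k))) -addrA; apply: (le_trans (ler_normD _ _)).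
  rewrite mulrDr [leLHS]addrC lerD ?Pl//; have := Hd (l + k).
  have -> : l + k - l = k by rewrite addrC addKr.
  rewrite gtr0_norm//; apply=> //.
  by rewrite lk addr_ge0// ltW.
- move=> l l0 Pl l1.
  have [d d0 Hd] := H l (introT andP (conj (ltW l0) l1)).
  pose k := Num.max 0 (l - d).
  have kl : k < l by rewrite gt_max l0 ltrBlDr ltrDl d0.
  have k0 : 0 <= k by rewrite le_max lexx.
  have kd : l - k <= d by rewrite lerBlDr -lerBlDl le_max lexx orbT.
  have := Hd k; rewrite distrC ger0_norm ?subr_ge0 ?(ltW kl)// k0 (le_trans (ltW kl) l1)/=.
  move=> /(_ isT kd) H1.
  have H2 := Pl k (introT andP (conj k0 kl)) (le_trans (ltW kl) l1).
  rewrite -(subrK (h k) (h l)) -addrA; apply: (le_trans (ler_normD _ _)).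
  rewrite distrC; apply: (le_trans (lerD H1 H2)).
  by rewrite -mulrDr subrK.
Qed.

Lemma is_frechetP X f x L : is_frechet X f x L <-> continuous L /\
  forall e : R, 0 < e -> exists2 d : R, 0 < d &
    forall y, X y -> `|y - x| < d -> `|f y - f x - L (y - x)| <= e * `|y - x|.
Proof.
split=> -[Lc H]; split=> //.
  move=> e e0; move/eqoP : H => /(_ e e0); rewrite near_withinE.
  move=> /nbhs_normP[d /= d0 Hd]; exists d => // y Xy yx.
  by apply: Hd => //=; rewrite distrC.
apply/eqoP => e e0; have [d d0 Hd] := H e e0.
rewrite near_withinE; apply/nbhs_normP; exists d => //= y yx Xy.
by apply: Hd => //; rewrite distrC.
Qed.

Lemma frechet_ext X f g x L M : X x -> (forall y, X y -> f y = g y) ->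
  L =1 M -> is_frechet X f x L -> is_frechet X g x M.
Proof.
move=> Xx fg LM /is_frechetP[Lc H]; apply/is_frechetP; split.
  by rewrite -(_ : L = M :> (_ -> _))//; apply/funext.
move=> e /H[d d0 Hd]; exists d => // y Xy yd.
by rewrite -!fg// -LM; exact: Hd.
Qed.

Lemma continuous_linear_le L : continuous L ->
  exists2 C : R, 0 < C & forall v, `|L v| <= C * `|v|.
Proof.
move=> /linear_bounded_continuous/linear_boundedP H.
near (pinfty_nbhs R) => C; exists C; first by near: C; exact: nbhs_pinfty_gt.
by near: C.
Unshelve. all: by end_near. Qed.

Lemma frechet_comp X f g x L M : X x -> (forall y, X y -> X (f y)) ->
  is_frechet X f x L -> is_frechet X g (f x) M ->
  is_frechet X (g \o f) x (M \o L).
Proof.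
move=> Xx fX /is_frechetP[Lc HL] /is_frechetP[Mc HM]; apply/is_frechetP; split.
  by move=> y; apply: continuous_comp; [exact: Lc|exact: Mc].
move=> e e0.
have [CL CL0 HCL] := continuous_linear_le Lc.
have [CM CM0 HCM] := continuous_linear_le Mc.
have C1 : 0 < CL + 1 by rewrite addr_gt0.
have [dM dM0 HdM] := HM (e / 2 / (CL + 1)) (divr_gt0 (divr_gt0 e0 (ltr0Sn _ 1)) C1).
have [|d1 d10 Hd1] := HL (Num.min 1 (e / 2 / CM)).
  by rewrite lt_min ltr01/= !divr_gt0.
exists (Num.min d1 (dM / (CL + 1))); first by rewrite lt_min d10 divr_gt0.
move=> y Xy; rewrite lt_min => /andP[yd1 ydM].
have {}Hd1 := Hd1 _ Xy yd1.
have fle : `|f y - f x| <= (CL + 1) * `|y - x|.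
  rewrite -(subrK (L (y - x)) (f y - f x)); apply: (le_trans (ler_normD _ _)).
  rewrite mulrDl addrC lerD// mul1r; apply: (le_trans Hd1).
  by rewrite ler_piMl// ge_min lexx.
have fd : `|f y - f x| < dM.
  by apply: (le_lt_trans fle); rewrite mulrC -ltr_pdivlMr.
have {}HdM := HdM _ (fX _ Xy) fd.
rewrite /= -(subrK (M (f y - f x)) (g (f y) - g (f x))) -addrA -linearB.
apply: (le_trans (ler_normD _ _)); rewrite [e in leRHS]splitr mulrDl lerD//.
  apply: (le_trans HdM).
  have -> : e / 2 * `|y - x| = e / 2 / (CL + 1) * ((CL + 1) * `|y - x|).
    by field; rewrite gt_eqF.
  by rewrite ler_pM2l// !divr_gt0.
apply: (le_trans (HCM _)); rewrite -ler_pdivlMl// mulrA [_^-1 * _]mulrC.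
apply: (le_trans Hd1); rewrite ler_wpM2r//.
by rewrite ge_min lexx orbT.
Qed.

(** Strict differentiability: the mean value inequality is applied to [f - D x] along the segment
    from [p] to [q], where [D] stays close to [D x]. The derivatives are relative to [X], so the
    segment is required to lie in [X]. *)
Lemma C1_strict X f x : X x -> C1_on X f -> exists L,
  is_frechet X f x L /\ forall e : R, 0 < e -> exists2 d : R, 0 < d &
    forall p q, `|p - x| < d -> `|q - x| < d ->
      (forall t : R, 0 <= t <= 1 -> X (p + t *: (q - p))) ->
      `|f q - f p - L (q - p)| <= e * `|q - p|.
Proof.
move=> Xx [D [HD HC]]; exists (D x); split; first exact: HD.
move=> e e0; have e20 : 0 < e / 2 by rewrite divr_gt0.
have := HC x Xx (e / 2) e20; rewrite near_withinE => /nbhs_normP[d /= d0 Hd].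
exists d => // p q px qx HX; set v := q - p.
pose h (t : R) := f (p + t *: v) - t *: D x v.
have -> : f q - f p - D x v = h 1 - h 0.
  by rewrite /h !scale1r !scale0r addr0 subr0 subrKC addrAC.
apply: local_lipschitz; first by rewrite mulr_ge0// ltW.
move=> s s01; pose z := p + s *: v.
have Xz : X z by exact: HX.
have zx : `|x - z| < d.
  have -> : x - z = (1 - s) *: (x - p) + s *: (x - q).
    rewrite scalerBl scale1r -addrA [- _ + _]addrC -scalerBr opprB.
    rewrite [x - q + _]addrC addrA subrK /z /v opprD addrA -scalerN opprB.
    by [].
  have [s0 s1] := andP s01.
  apply: (@le_lt_trans _ _ (Num.max `|p - x| `|q - x|)); last by rewrite gt_max px.
  apply: (le_trans (ler_normD _ _)); rewrite !normrZ ger0_norm ?subr_ge0//.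
  rewrite ger0_norm// (distrC x) (distrC x); set m := Num.max _ _.
  have -> : m = (1 - s) * m + s * m by rewrite -mulrDl subrK mul1r.
  by rewrite lerD// ler_wpM2l ?subr_ge0// le_max lexx ?orbT.
have /is_frechetP[_ /(_ _ e20)[d1 d10 Hd1]] := HD z Xz.
exists (d1 / (1 + `|v|) / 2); first by rewrite !divr_gt0// ltr_pwDl.
move=> t t01 ts.
have yz : p + t *: v - z = (t - s) *: v.
  by rewrite /z opprD addrACA subrr add0r scalerBl.
have -> : h t - h s = (f (p + t *: v) - f z - D z (p + t *: v - z)) +
   (D z ((t - s) *: v) - D x ((t - s) *: v)).
  have DxZ : D x ((t - s) *: v) = (t - s) *: D x v by rewrite linearZ.
  rewrite yz addrA subrK DxZ scalerBl /h -/z !opprB.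
  by rewrite addrACA [RHS]addrACA; congr (_ + _); rewrite addrC.
apply: (le_trans (ler_normD _ _)).
have -> : e * `|v| * `|t - s| = e / 2 * `|(t - s) *: v| + e / 2 * `|(t - s) *: v|.
  by rewrite -mulrDl -splitr normrZ; ring.
rewrite lerD//; last exact: Hd.
rewrite -yz; apply: Hd1; first exact: HX.
rewrite yz normrZ.
have v1 : 0 < 1 + `|v| by rewrite ltr_pwDl.
apply: (@le_lt_trans _ _ (d1 / (1 + `|v|) / 2 * `|v|)); first by rewrite ler_wpM2r.
rewrite mulrAC ltr_pdivrMr// mulrAC ltr_pdivrMr// -mulrA ltr_pM2l//.
by have := normr_ge0 v; lra.
Qed.

(** The set [X] may contain no point [x + t h] with [t > 0]. The difference quotient is therefore
    formed at a nearby [p] with [p << q]: order convexity keeps [p + t h] in [X] for small [t >= 0],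
    and strict differentiability at [x] compares the quotient with [L h]. *)
Lemma frechet_pos K X f x L u : order_cone K -> K° u -> order_convex K X ->
  (forall p q, X p -> X q -> cone_le K p q -> cone_le K (f p) (f q)) ->
  (forall e : R, 0 < e -> exists2 d : R, 0 < d &
    forall p q, `|p - x| < d -> `|q - x| < d ->
      (forall t : R, 0 <= t <= 1 -> X (p + t *: (q - p))) ->
      `|f q - f p - L (q - p)| <= e * `|q - p|) ->
  (forall d : R, 0 < d -> exists p q,
     [/\ X p, X q, cone_ll K p q & `|p - x| < d]) ->
  forall h, K h -> K (L h).
Proof.
move=> hK Ku hX fmono fstrict near_ll h Kh.
have [c c0 Hc] := cone_unit hK Ku.
apply: (cone_arch hK (v := u)) => e e0.
have h1 : 0 < 1 + `|h| by rewrite ltr_pwDl.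
have ch : 0 < c * (1 + `|h|) by rewrite mulr_gt0.
(* With this tolerance the linearization error along [b *: h] is absorbed by [b * e] times the order
   unit [u]. *)
have [d d0 Hd] := fstrict (e / (c * (1 + `|h|))) (divr_gt0 e0 ch).
have [p [q [Xp Xq pq px]]] := near_ll d d0.
have [a a0 Ka] := cone_int_absorb h pq.
(* The bound [a] keeps the segment below [q]; the other one keeps it within distance [d] of [x]. *)
pose b := Num.min a ((d - `|p - x|) / (1 + `|h|)).
have b0 : 0 < b by rewrite lt_min a0 divr_gt0// subr_gt0.
have Xb t : 0 <= t <= b -> X (p + t *: h).
  move=> /andP[t0 tb]; apply: (hX _ _ _ Xp Xq).
    by rewrite /cone_le addrC addKr; exact: (order_coneZ hK).
  rewrite /cone_le opprD addrA.
  have -> : q - p - t *: h = q - p - a *: h + (a - t) *: h.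
    by rewrite scalerBl addrA subrK.
  apply: (order_coneD hK) => //; apply: (order_coneZ hK) => //.
  by rewrite subr_ge0; apply: (le_trans tb); rewrite ge_min lexx.
have Xbh : X (p + b *: h) by apply: Xb; rewrite lexx ltW.
have Kpb : cone_le K p (p + b *: h).
  by rewrite /cone_le addrC addKr; apply: (order_coneZ hK) => //; exact: ltW.
have Kf : K (f (p + b *: h) - f p) := fmono _ _ Xp Xbh Kpb.
have pbh : p + b *: h - p = b *: h by rewrite addrC addKr.
have := Hd p (p + b *: h) px; rewrite pbh => Hs.
have {}Hs : `|f (p + b *: h) - f p - L (b *: h)| <= e / (c * (1 + `|h|)) * `|b *: h|.
  apply: Hs.
    rewrite addrAC; apply: (le_lt_trans (ler_normD _ _)).
    rewrite -ltrBrDl normrZ gtr0_norm//.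
    apply: (@le_lt_trans _ _ ((d - `|p - x|) / (1 + `|h|) * `|h|)).
      by rewrite ler_wpM2r// ge_min lexx orbT.
    rewrite mulrAC ltr_pdivrMr// ltr_pM2l ?subr_gt0//.
    by rewrite ltrDr.
  move=> t /andP[t0 t1]; rewrite scalerA; apply: Xb.
  by rewrite mulr_ge0 ?(ltW b0)//= ler_piMl// ltW.
set w := f (p + b *: h) - f p - L (b *: h) in Hs.
have := Hc (- w); rewrite normrN => Kw.
have : K (b *: (L h + e *: u)).
  have -> : b *: (L h + e *: u) = (c * `|w|) *: u - w + (f (p + b *: h) - f p) +
      (b * e - c * `|w|) *: u.
    have reorder (y z r : B) : y - w + z + r = (y + r) + (z - w).
      by rewrite -!addrA; congr (_ + _); rewrite addrC addrAC addrC.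
    have LZ : L (b *: h) = b *: L h by rewrite linearZ.
    by rewrite reorder subKr -scalerDl subrKC LZ scalerDr scalerA addrC.
  apply: (order_coneD hK); first exact: (order_coneD hK).
  apply: (order_coneZ hK); last exact: cone_int_sub.
  rewrite subr_ge0 -ler_pdivlMl//; apply: (le_trans Hs).
  rewrite normrZ gtr0_norm//.
  have -> : e / (c * (1 + `|h|)) * (b * `|h|) = c^-1 * (b * e) * (`|h| / (1 + `|h|)).
    by field; rewrite !gt_eqF.
  rewrite ler_piMr ?mulr_ge0 ?invr_ge0 ?(ltW c0) ?(ltW b0) ?(ltW e0)//.
  by rewrite ler_pdivrMr// mul1r lerDr.
move=> /(order_coneZ hK (ltW (_ : 0 < b^-1))); rewrite invr_gt0 => /(_ b0).
by rewrite scalerA mulVf ?gt_eqF// scale1r.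
Qed.

Definition direction (e a : B) : B := `|a - e|^-1 *: (a - e).

Lemma norm_direction e a : a <> e -> `|direction e a| = 1.
Proof.
move=> ae; rewrite normrZ ger0_norm ?invr_ge0// mulVf// normr_eq0 subr_eq0.
exact/eqP.
Qed.

(** For fixed points [a] of [f], the Frechet estimate reads [(a - e) - L (a - e) = o(a - e)];
    dividing by the norm gives the claim. *)
Lemma direction_defect X f e L (G : set_system B) {GP : ProperFilter G} :
  is_frechet X f e L -> f e = e -> G --> e ->
  (\forall a \near G, [/\ X a, a <> e & f a = a]) ->
  (fun a => direction e a - L (direction e a)) @ G --> (0 : B).
Proof.
move=> /is_frechetP[_ HL] fe Ge GA; apply/cvgrPdist_le => r r0.
have [d d0 Hd] := HL r r0.
have Gd : \forall a \near G, `|a - e| < d.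
  by apply: Ge; apply/nbhs_normP; exists d => //= a; rewrite distrC.
near=> a.
have [Xa ae fa] : [/\ X a, a <> e & f a = a] by near: a.
have n0 : 0 < `|a - e| by rewrite normr_gt0 subr_eq0; exact/eqP.
rewrite sub0r normrN /direction linearZ /= -scalerBr normrZ ger0_norm ?invr_ge0//.
rewrite ler_pdivrMl// mulrC.
have := Hd a Xa; rewrite fa fe; apply.
by near: a.
Unshelve. all: by end_near. Qed.

Lemma fixed_direction X f e L (G : set_system B) {GP : ProperFilter G} w :
  is_frechet X f e L -> f e = e -> G --> e ->
  (\forall a \near G, [/\ X a, a <> e & f a = a]) ->
  direction e @ G --> w -> L w = w.
Proof.
move=> fL fe Ge GA Gw; have /(_ _) H := direction_defect fL fe Ge GA.
have Lw : (L \o direction e) @ G --> L w.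
  by apply: continuous_cvg => //; have [Lc _] := fL; exact: Lc.
have D : (fun a => direction e a - L (direction e a)) @ G --> w - L w.
  exact: cvgB.
by apply/esym/eqP; rewrite -subr_eq0; apply/eqP; exact: norm_cvg_unique D H.
Qed.

(** Unit directions need not be relatively compact, but their images under the compact [L] are, and
    the two differ by the vanishing defect. *)
Lemma direction_limit X f e L (A : set B) : compact_linear L ->
  is_frechet X f e L -> f e = e -> (forall a, A a -> X a /\ f a = a) ->
  (forall d : R, 0 < d -> exists a, [/\ A a, a <> e & `|a - e| < d]) ->
  exists G : set_system B, [/\ ProperFilter G, G --> e,
    \forall a \near G, A a /\ a <> e &
    exists2 w, `|w| = 1 & direction e @ G --> w].
Proof.
move=> Lcpt fL fe fA HA.
pose F := within [set a | A a /\ a <> e] (nbhs e).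
have FP : ProperFilter F.
  apply: within_nbhs_proper => U /nbhs_normP[d /= d0 Hd].
  have [a [Aa ae ad]] := HA d d0; exists a; split => //.
  by apply: Hd; rewrite /= distrC.
have [C cC HC] := Lcpt 1.
have FA : \forall a \near F, A a /\ a <> e.
  by rewrite near_withinE; near=> a.
have [|G [GP FG [w _ Gw]]] := @compact_refine _ _ F _ C (L \o direction e) cC.
  near=> a; apply: HC; rewrite norm_direction//.
  by have [] : A a /\ a <> e by near: a.
have Ge : G --> e by move=> U Ue; apply: FG; apply: filterS Ue => a Ua _.
have GA : \forall a \near G, [/\ X a, a <> e & f a = a].
  by apply: FG; apply: filterS FA => a [/fA[]].
have Gdir : direction e @ G --> w.
  rewrite -[w]add0r.
  rewrite (_ : direction e = fun a => (direction e a - L (direction e a)) + L (direction e a)).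
    by apply: cvgD => //; exact: direction_defect fL fe Ge GA.
  by apply/funext => a; rewrite subrK.
exists G; split => //; first exact: FG.
exists w => //.
apply: (norm_cvg_unique (cvg_norm Gdir)); apply: cvg_near_cst.
by apply: filterS GA => a [_ ae _]; exact: norm_direction.
Unshelve. all: by end_near. Qed.

End Calculus.

(** * Omega limit sets *)

Lemma filter_near_int {R : realType} {B : normedModType R} {K : set B} {I : Type}
    {F : set_system I} {FF : Filter F} {f : I -> B} {x : B} :
  K° x -> f @ F --> x -> \forall i \near F, K° (f i).
Proof.
move=> Kx fx; apply: (fx (K°)); apply: open_nbhs_nbhs.
by split => //; exact: open_interior.
Qed.

Section OmegaLimit.
Context {R : realType} {B : normedModType R}.
Variables (X : set B) (Phi : R -> B -> B).
Hypothesis hPhi : semiflow X Phi.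
Hypothesis horb : forall x, X x -> compact (orbit_closure X Phi x).
Implicit Types (x y p q : B) (G : set_system R).

Let w := omega_limit X Phi.

Lemma flow_cvg {I : Type} {F : set_system I} {FF : Filter F} (f : I -> R)
    (g : I -> B) t x : f @ F --> t -> g @ F --> x -> 0 <= t -> X x ->
  (\forall i \near F, 0 <= f i) -> (\forall i \near F, X (g i)) ->
  (fun i => Phi (f i) (g i)) @ F --> Phi t x.
Proof.
move=> ft gx t0 Xx f0 Xg.
have /subspace_continuousP/(_ (t, x)) H := semiflow_cont hPhi.
have {}H := H (conj t0 Xx).
have fg : (fun i => (f i, g i)) @ F --> (t, x) by exact: (cvg_pair ft gx).
move=> U /H HU; have := fg _ HU.
by apply: (filterS3 _ _ f0 Xg) => i fi0 Xgi /=; apply.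
Qed.

Lemma flow_cvg_point {I : Type} {F : set_system I} {FF : Filter F}
    (g : I -> B) t x : g @ F --> x -> 0 <= t -> X x ->
  (\forall i \near F, X (g i)) -> (fun i => Phi t (g i)) @ F --> Phi t x.
Proof.
move=> gx t0 Xx Xg; apply: flow_cvg => //; first exact: cvg_cst.
exact: nearW.
Qed.

Lemma flow_cvg_time {I : Type} {F : set_system I} {FF : Filter F} (f : I -> R)
    t x : f @ F --> t -> 0 <= t -> X x -> (\forall i \near F, 0 <= f i) ->
  (fun i => Phi (f i) x) @ F --> Phi t x.
Proof.
move=> ft t0 Xx f0; apply: flow_cvg => //; first exact: cvg_cst.
exact: nearW.
Qed.

Lemma near_time_ge G (a : R) : pinfty_nbhs R `<=` G -> \forall t \near G, a <= t.
Proof. by apply; apply: nbhs_pinfty_ge; exact: num_real. Qed.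

Lemma omega_limit_sub x p : w x p -> X p.
Proof. by move=> /(_ 0 (lexx _))[]. Qed.

(** The filter is generated by the sets of late times at which the trajectory is close to [p]; it
    plays the role of a sequence of times tending to infinity. *)
Lemma omega_limit_filter x p : w x p -> exists G : set_system R,
  [/\ ProperFilter G, pinfty_nbhs R `<=` G & (fun t => Phi t x) @ G --> p].
Proof.
move=> wp.
pose D := [set te : R * R | 0 <= te.1 /\ 0 < te.2].
pose S (te : R * R) := [set s : R | te.1 <= s /\ `|p - Phi s x| < te.2].
have FS : Filter (filter_from D S).
  apply: filter_from_filter; first by exists (0, 1); split => /=.
  move=> [t e] [t' e'] [/= t0 e0] [/= t0' e0'].
  exists (Num.max t t', Num.min e e').
    by split => /=; [rewrite le_max t0|rewrite lt_min e0].
  move=> s [] /=; rewrite ge_max lt_min => /andP[ts ts'] /andP[se se'].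
  by split; split.
exists (filter_from D S); split.
- apply: filter_from_proper => -[t e] [/= t0 e0].
  have [_ cl] := wp t t0.
  have [|_ [[s ts <-] /= sp]] := cl (ball p e); first exact: nbhsx_ballx.
  by exists s; split => //=; move: sp; rewrite -ball_normE.
- move=> U [M [_ HM]]; exists (Num.max 0 (M + 1), 1).
    by split => //=; rewrite le_max lexx.
  move=> s [/=]; rewrite ge_max => /andP[_ Ms] _; apply: HM.
  by apply: lt_le_trans Ms; rewrite ltrDl.
- apply/cvgrPdist_lt => e e0; exists (0, e); first by split.
  by move=> s [].
Qed.

Lemma omega_limit_intro x p G {GP : ProperFilter G} : X p ->
  pinfty_nbhs R `<=` G -> (fun t => Phi t x) @ G --> p -> w x p.
Proof.
move=> Xp infG Gp t t0; split => // U Up.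
have [s [ts Us]] : exists s, t <= s /\ U (Phi s x).
  by apply: (@filter_ex _ G); apply: filterI; [exact: near_time_ge|exact: Gp].
by exists (Phi s x); split => //; exists s.
Qed.

Lemma omega_limit_refine x G {GP : ProperFilter G} : X x ->
  pinfty_nbhs R `<=` G -> exists G', [/\ ProperFilter G', G `<=` G' &
    exists2 p, w x p & (fun t => Phi t x) @ G' --> p].
Proof.
move=> Xx infG.
have [|G' [GP' GG' [p [Xp _] Gp]]] :=
    @compact_refine _ _ G _ _ (fun t => Phi t x) (horb Xx).
  apply: filterS (near_time_ge 0 infG) => t t0; split.
    by apply: (semiflow_stable hPhi).
  by apply: subset_closure; exists t.
exists G'; split => //; exists p => //.
by apply: (omega_limit_intro (G := G')) => // U /infG/GG'.
Qed.

Lemma omega_limit_neq0 x : X x -> w x !=set0.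
Proof.
move=> Xx; have [//|_ [_ _ [p wp _]]] := @omega_limit_refine x (pinfty_nbhs R) _ Xx.
by exists p.
Qed.

Lemma omega_limit_flow x p t : X x -> 0 <= t -> w x p -> w x (Phi t p).
Proof.
move=> Xx t0 wp; have Xp := omega_limit_sub wp.
have [G [GP infG Gp]] := omega_limit_filter wp.
apply: (omega_limit_intro (G := (fun s => t + s) @ G)).
- by apply: (semiflow_stable hPhi).
- move=> U [M [Mr HM]]; apply: infG; exists (M - t); split; first exact: num_real.
  by move=> s Ms; apply: HM; rewrite -ltrBlDl.
- have H : (fun s => Phi t (Phi s x)) @ G --> Phi t p.
    apply: flow_cvg_point => //; apply: filterS (near_time_ge 0 infG) => s s0.
    by apply: (semiflow_stable hPhi).
  move=> U /H; rewrite /nbhs /=; apply: filterS2 (near_time_ge 0 infG) => s s0 /=.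
  by rewrite (semiflowD hPhi).
Qed.

(** Shift the times converging to [p] back by [t] and refine by compactness of the orbit closure;
    continuity of [Phi t] carries the new limit to [p]. *)
Lemma omega_limit_backward x p t : X x -> 0 <= t -> w x p ->
  exists2 q, w x q & Phi t q = p.
Proof.
move=> Xx t0 wp; have [G [GP infG Gp]] := omega_limit_filter wp.
pose H := (fun s => s - t) @ G.
have infH : pinfty_nbhs R `<=` H.
  move=> U [M [Mr HM]]; apply: infG; exists (M + t); split; first exact: num_real.
  by move=> s Ms; apply: HM; rewrite ltrBrDr.
have [//|H' [HP' HH' [q wq Hq]]] := @omega_limit_refine x H _ Xx.
exists q => //; have Xq := omega_limit_sub wq.
have H1 : (fun s => Phi t (Phi s x)) @ H' --> Phi t q.
  apply: flow_cvg_point => //.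
  have infH' : pinfty_nbhs R `<=` H' by move=> U /infH/HH'.
  apply: filterS (near_time_ge 0 infH') => s s0.
  by apply: (semiflow_stable hPhi).
apply: (norm_cvg_unique H1) => U Up; apply: HH'; rewrite /H /nbhs /=.
have := Gp U Up; rewrite /nbhs /=; apply: filterS2 (near_time_ge t infG) => s ts /=.
by rewrite (semiflowD hPhi) ?subr_ge0// subrKC.
Qed.

Lemma omega_limit_trans x p : X x -> w x p -> w p `<=` w x.
Proof.
move=> Xx wp q wq t t0; have [Xq cq] := wq t t0; split => // U Uq.
have [_ [[s ts <-]]] := cq (U^°)%classic (nbhs_interior Uq).
move=> /= Us; have s0 : 0 <= s by exact: le_trans ts.
have /(_ t t0)[_ cs] := omega_limit_flow Xx s0 wp.
exact: cs.
Qed.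

Lemma omega_limit_compact x : X x -> compact (w x).
Proof.
move=> Xx.
have -> : w x = orbit_closure X Phi x `&`
    \bigcap_(t in [set t : R | 0 <= t]) closure (orbit_from Phi t x).
  apply/seteqP; split => [p wp|p [[Xp _] cp] t t0]; last by split => //; exact: cp.
  split; first exact: wp 0 (lexx _).
  by move=> t t0; have [] := wp t t0.
apply: compact_closedI; first exact: horb.
by apply: closed_bigI => t _; exact: closed_closure.
Qed.

Lemma equilibrium_omega_limit x e : X x -> w x = [set e] -> equilibria X Phi e.
Proof.
move=> Xx we; have wxe : w x e by rewrite we.
split; first exact: omega_limit_sub wxe.
by move=> t t0; have := omega_limit_flow Xx t0 wxe; rewrite we.
Qed.

Lemma flow_iter_fixed p l n : 0 <= l -> X p -> Phi l p = p -> Phi (l *+ n) p = p.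
Proof.
move=> l0 Xp lp; elim: n => [|n IH]; first by rewrite mulr0n (semiflow0 hPhi).
by rewrite mulrS -(semiflowD hPhi) ?mulrn_wge0// IH.
Qed.

(** Every positive time is an integer multiple of a time shorter than [d]. *)
Lemma equilibrium_small_times p d : 0 < d -> X p ->
  (forall l, 0 < l < d -> Phi l p = p) -> equilibria X Phi p.
Proof.
move=> d0 Xp H; split => // t; rewrite le_eqVlt => /orP[/eqP <-|t0].
  by apply: (semiflow0 hPhi).
have [n nd] : exists n : nat, t / n.+1%:R < d.
  have := near_infty_natSinv_lt (PosNum (divr_gt0 d0 t0)).
  by move=> /filter_ex[n /=]; rewrite ltr_pdivlMr// mulrC; exists n.
rewrite -[t](divfK (lt0r_neq0 (ltr0Sn R n))) mulr_natr.
by apply: flow_iter_fixed; rewrite ?divr_ge0 ?(ltW t0)//; apply: H; rewrite divr_gt0.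
Qed.

End OmegaLimit.

(** * The limit set dichotomy *)

Section MonotoneFlow.
Context {R : realType} {B : normedModType R}.
Variables (K X : set B) (Phi : R -> B -> B) (t1 : R).
Hypothesis hK : order_cone K.
Hypothesis hPhi : semiflow X Phi.
Hypothesis horb : forall x, X x -> compact (orbit_closure X Phi x).
Hypothesis hmono : monotone_flow K X Phi.
Hypothesis t1_ge0 : 0 <= t1.
Hypothesis hstrong : forall x y t, X x -> X y -> cone_lt K x y -> t1 <= t ->
  cone_ll K (Phi t x) (Phi t y).
Implicit Types (x y z a b c p q : B) (G : set_system R).

Let w := omega_limit X Phi.
Let Xflow t x : 0 <= t -> X x -> X (Phi t x).
Proof. by move=> t0 Xx; apply: (semiflow_stable hPhi). Qed.

Lemma flow_le_iter z l n : X z -> 0 <= l -> cone_le K z (Phi l z) ->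
  cone_le K z (Phi (l *+ n) z).
Proof.
move=> Xz l0 zl; elim: n => [|n IH].
  by rewrite mulr0n (semiflow0 hPhi)// /cone_le subrr; exact: order_cone0 hK.
apply: (cone_le_trans hK zl).
have := hmono Xz (Xflow (mulrn_wge0 n l0) Xz) l0 IH.
by rewrite (semiflowD hPhi) ?mulrn_wge0// mulrS.
Qed.

(* Every large time is a multiple [n * l] with [l] in the window around [T]. *)
Lemma flow_le_large_times z (T d : R) : X z -> 0 < T -> 0 < d ->
  (forall l, T <= l <= T + d -> cone_le K z (Phi l z)) ->
  exists2 s0 : R, 0 <= s0 & forall s, s0 <= s -> cone_le K z (Phi s z).
Proof.
move=> Xz T0 d0 H.
have [N Nd] : exists N : nat, T / N.+1%:R < d.
  have := near_infty_natSinv_lt (PosNum (divr_gt0 d0 T0)).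
  by move=> /filter_ex[n /=]; rewrite ltr_pdivlMr// mulrC; exists n.
exists (T * N.+1%:R); first by rewrite mulr_ge0// ltW.
move=> s sT; pose n := Num.truncn (s / T).
have s0 : 0 <= s by apply: le_trans sT; rewrite mulr_ge0// ltW.
have /andP[n1 n2] := truncn_itv (divr_ge0 s0 (ltW T0)).
have Nn : (N.+1 <= n)%N.
  rewrite -ltnS -(ltr_nat R); apply: le_lt_trans n2.
  by rewrite ler_pdivlMr// mulrC.
have n0 : 0 < n%:R :> R by rewrite ltr0n; exact: leq_trans Nn.
rewrite -[s](divfK (lt0r_neq0 n0)) mulr_natr.
apply: flow_le_iter => //; first by rewrite divr_ge0// ltW.
apply: H; rewrite ler_pdivlMr// mulrC -ler_pdivlMr// n1/=.
rewrite ler_pdivrMr// mulrDl; apply: (@le_trans _ _ (T * n.+1%:R)).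
  by rewrite mulrC -ler_pdivrMr// ltW.
rewrite -natr1 mulrDr mulr1 lerD2l.
have : T <= d * N.+1%:R by rewrite -ler_pdivrMr// ltW.
by move=> /le_trans; apply; rewrite ler_pM2l// ler_nat.
Qed.

(** If [a < b], the trajectory passes from near [Phi t1 a] to near [Phi t1 b], so one of its points
    [z] lies below [Phi l z] for an interval of [l], hence for all large [l]. The trajectory is then
    increasing up to a fixed delay, all limit points are mutually ordered, and antisymmetry
    identifies them. *)
Lemma omega_limit_unordered x a b : X x -> w x a -> w x b ->
  cone_le K a b -> a = b.
Proof.
move=> Xx wa wb ab; apply: contrapT => neab.
have Xa := omega_limit_sub wa; have Xb := omega_limit_sub wb.
have ll := hstrong Xa Xb (conj ab neab) (lexx _).
have [Ga [GaP infGa Ga1]] := omega_limit_filter (omega_limit_flow hPhi Xx t1_ge0 wa).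
have [Gb [GbP infGb Gb1]] := omega_limit_filter (omega_limit_flow hPhi Xx t1_ge0 wb).
have [s1 [s10 Hs1]] : exists s, 0 <= s /\ K° (Phi t1 b - Phi s x).
  apply: (@filter_ex _ Ga); apply: filterI; first exact: near_time_ge.
  by apply: (filter_near_int ll); apply: cvgB => //; exact: cvg_cst.
have [s2 [s12 Hs2]] : exists s, s1 + 1 <= s /\ K° (Phi s x - Phi s1 x).
  apply: (@filter_ex _ Gb); apply: filterI; first exact: near_time_ge.
  by apply: (filter_near_int Hs1); apply: cvgB => //; exact: cvg_cst.
pose z := Phi s1 x; have Xz : X z by exact: Xflow.
have s20 : 0 < s2 by apply: lt_le_trans s12; rewrite ltr_wpDl.
have : \forall s \near s2, K° (Phi s x - z).
  apply: (filter_near_int (F := nbhs s2) Hs2); apply: cvgB; last exact: cvg_cst.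
  apply: (flow_cvg_time hPhi) => //; first exact: ltW.
  by apply: filterS (lt_nbhsr s20) => s /ltW.
move=> /nbhs_normP[d /= d0 Hd].
have T0 : 0 < s2 - s1 by rewrite subr_gt0; apply: lt_le_trans s12; rewrite ltrDl.
have d20 : 0 < d / 2 by rewrite divr_gt0.
(* Halving [d] keeps the closed window of times strictly inside the ball where the order is
   strong. *)
have [|r0 r00 Hr] := @flow_le_large_times z _ _ Xz T0 d20.
  move=> l /andP[l1 l2].
  have l0 : 0 <= l by exact: le_trans (ltW T0) l1.
  rewrite /cone_le [Phi l z](semiflowD hPhi)//; apply: cone_int_sub; apply: (Hd (l + s1)) => /=.
  have -> : s2 - (l + s1) = - (l - (s2 - s1)) by ring.
  rewrite normrN ger0_norm ?subr_ge0//.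
  by apply: (@le_lt_trans _ _ (d / 2)); [rewrite lerBlDl|
    rewrite ltr_pdivrMr// mulr_natr mulr2n ltrDl].
(* Monotonicity in time up to the delay [r0], transported from [z] along the orbit. *)
have H t t' : s1 <= t -> t + r0 <= t' -> cone_le K (Phi t x) (Phi t' x).
  move=> st tt'; have r0t : r0 <= t' - t by rewrite lerBrDl.
  have t't : 0 <= t' - t by exact: le_trans r0t.
  have zt := Hr _ r0t; have ts : 0 <= t - s1 by rewrite subr_ge0.
  have := hmono Xz (Xflow t't Xz) ts zt.
  have e1 : Phi (t - s1) z = Phi t x by rewrite (semiflowD hPhi)// subrK.
  have e2 : Phi (t - s1) (Phi (t' - t) z) = Phi t' x.
    rewrite [Phi _ z](semiflowD hPhi)// (semiflowD hPhi ts (addr_ge0 t't s10) Xx).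
    by congr (Phi _ x); ring.
  by rewrite e1 e2.
have le_w p q : w x p -> w x q -> cone_le K p q.
  move=> /omega_limit_filter[Gp [GpP infGp Gp1]].
  move=> /omega_limit_filter[Gq [GqP infGq Gq1]].
  apply: (cone_le_lim hK (F := Gp) _ Gp1 (cvg_cst q)).
  apply: filterS (near_time_ge s1 infGp) => t st.
  apply: (cone_le_lim hK (F := Gq) _ (cvg_cst _) Gq1).
  by apply: filterS (near_time_ge (t + r0) infGq) => t'; exact: H.
by apply: neab; apply: (cone_le_antisym hK); exact: le_w.
Qed.

(** The strong order at time [t1] leaves room to delay either trajectory by a small [l]. Passing to
    the common limit gives [Phi l p <= p] and [p <= Phi l p]. *)
Lemma colimit_equilibrium x y p G {GP : ProperFilter G} : X x -> X y ->
  cone_lt K x y -> pinfty_nbhs R `<=` G ->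
  (fun t => Phi t x) @ G --> p -> (fun t => Phi t y) @ G --> p -> X p ->
  equilibria X Phi p.
Proof.
move=> Xx Xy xy infG Gx Gy Xp.
have ll := hstrong Xx Xy xy (lexx _).
have t1l : (fun l : R => t1 + l) @ 0^'+ --> t1.
  rewrite -[X in _ --> X]addr0; apply: cvgD; first exact: cvg_cst.
  by apply: cvg_at_right_filter; exact: cvg_id.
have ft1 z : X z -> (fun l : R => Phi (t1 + l) z) @ 0^'+ --> Phi t1 z.
  move=> Xz; apply: (flow_cvg_time hPhi) => //.
  by near=> l; rewrite addr_ge0//; apply: ltW; near: l; exact: nbhs_right_gt.
have H1 : \forall l \near 0^'+, K° (Phi t1 y - Phi (t1 + l) x).
  by apply: (filter_near_int ll); apply: cvgB; [exact: cvg_cst|exact: ft1].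
have H2 : \forall l \near 0^'+, K° (Phi (t1 + l) y - Phi t1 x).
  by apply: (filter_near_int ll); apply: cvgB; [exact: ft1|exact: cvg_cst].
have [d /= d0 Hd] : \forall l \near 0^'+, K° (Phi t1 y - Phi (t1 + l) x) /\
    K° (Phi (t1 + l) y - Phi t1 x) by exact: filterI.
apply: (equilibrium_small_times hPhi d0 Xp) => l /andP[l0 ld].
have [] := Hd l _ l0; first by rewrite /= sub0r normrN gtr0_norm.
move=> /cone_int_sub le1 /cone_int_sub le2.
have l0' := ltW l0.
have Gl z : X z -> (fun t => Phi t z) @ G --> p ->
    (fun t => Phi (t - t1 + (t1 + l)) z) @ G --> Phi l p.
  move=> Xz Gz.
  have H : (fun t => Phi l (Phi t z)) @ G --> Phi l p.
    apply: (flow_cvg_point hPhi) => //.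
    by apply: filterS (near_time_ge 0 infG) => t t0; exact: Xflow.
  move=> U /H; rewrite /nbhs /=; apply: filterS2 (near_time_ge 0 infG) => t t0 /=.
  by rewrite (semiflowD hPhi)// (_ : t - t1 + (t1 + l) = l + t)//; ring.
have shift a b (s s' : R) : X a -> X b -> 0 <= s -> 0 <= s' ->
    cone_le K (Phi s a) (Phi s' b) -> forall t, t1 <= t ->
    cone_le K (Phi (t - t1 + s) a) (Phi (t - t1 + s') b).
  move=> Xa Xb s0 s'0 ab t; rewrite -subr_ge0 => tt1.
  rewrite -(semiflowD hPhi tt1 s0 Xa) -(semiflowD hPhi tt1 s'0 Xb).
  by apply: hmono => //; exact: Xflow.
have Gl1 z : X z -> (fun t => Phi t z) @ G --> p ->
    (fun t => Phi (t - t1 + t1) z) @ G --> p.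
  by move=> Xz; rewrite (_ : (fun t => Phi (t - t1 + t1) z) = fun t => Phi t z)//;
     apply/funext => t; rewrite subrK.
apply: (cone_le_antisym hK).
  apply: (cone_le_lim hK (F := G) _ (Gl x Xx Gx) (Gl1 y Xy Gy)).
  apply: filterS (near_time_ge t1 infG) => t; apply: shift => //.
  exact: addr_ge0.
apply: (cone_le_lim hK (F := G) _ (Gl1 x Xx Gx) (Gl y Xy Gy)).
apply: filterS (near_time_ge t1 infG) => t; apply: shift => //.
exact: addr_ge0.
Unshelve. all: by end_near. Qed.

(** Induction on [l]. The point [Phi l p] belongs to the limit set of [x] and [q] does not, so
    [Phi l p <= q] is strict. Strong monotonicity then gives an inequality between the two
    trajectories with room to enlarge [l], and flowing on along [G] brings it back to [p] and
    [q]. *)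
Lemma limit_pair_dominates x y p q G {GP : ProperFilter G} : X x -> X y ->
  cone_le K x y -> pinfty_nbhs R `<=` G -> (fun t => Phi t x) @ G --> p ->
  (fun t => Phi t y) @ G --> q -> w x p -> w y q -> ~ w x q ->
  forall l, 0 <= l -> cone_le K (Phi l p) q.
Proof.
move=> Xx Xy xy infG Gx Gy wp wq nwq.
have Xp := omega_limit_sub wp; have Xq := omega_limit_sub wq.
have GX z : X z -> \forall t \near G, X (Phi t z).
  by move=> Xz; apply: filterS (near_time_ge 0 infG) => t t0; exact: Xflow.
apply: real_induction.
- rewrite (semiflow0 hPhi)//; apply: (cone_le_lim hK (F := G) _ Gx Gy).
  by apply: filterS (near_time_ge 0 infG) => t t0; exact: hmono.
- move=> l l0 pq.
  have Xlp := Xflow l0 Xp.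
  have lt : cone_lt K (Phi l p) q.
    by split=> // lpq; apply: nwq; rewrite -lpq; exact: omega_limit_flow.
  have := hstrong Xlp Xq lt (lexx _); rewrite (semiflowD hPhi)// => ll.
  have t1l : 0 <= t1 + l by exact: addr_ge0.
  have [s [s0 Hs]] : exists s, 0 <= s /\ K° (Phi t1 (Phi s y) - Phi (t1 + l) (Phi s x)).
    apply: (@filter_ex _ G); apply: filterI; first exact: near_time_ge.
    apply: (filter_near_int ll); apply: cvgB.
      by apply: (flow_cvg_point hPhi) => //; exact: GX.
    by apply: (flow_cvg_point hPhi) => //; exact: GX.
  have Xsx := Xflow s0 Xx; have Xsy := Xflow s0 Xy.
  have [d /= d0 Hd] : \forall h \near 0^'+,
      K° (Phi t1 (Phi s y) - Phi (t1 + l + h) (Phi s x)).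
    apply: (filter_near_int Hs); apply: cvgB; first exact: cvg_cst.
    apply: (flow_cvg_time hPhi) => //.
      rewrite -[X in _ --> X]addr0; apply: cvgD; first exact: cvg_cst.
      by apply: cvg_at_right_filter; exact: cvg_id.
    by near=> h; rewrite addr_ge0//; apply: ltW; near: h; exact: nbhs_right_gt.
  exists (d / 2); first by rewrite divr_gt0.
  move=> h /andP[h0 hd].
  have hd' : h < d.
    by apply: (le_lt_trans hd); rewrite ltr_pdivrMr// mulr_natr mulr2n ltrDl.
  have t1lh : 0 <= t1 + l + h by rewrite addr_ge0// ltW.
  have le1 : cone_le K (Phi (t1 + l + h + s) x) (Phi (t1 + s) y).
    rewrite -(semiflowD hPhi t1lh s0 Xx) -(semiflowD hPhi t1_ge0 s0 Xy).
    rewrite /cone_le; apply: cone_int_sub; apply: (Hd h) => //.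
    by rewrite /= sub0r normrN gtr0_norm.
  have lh0 : 0 <= l + h by rewrite addr_ge0// ltW.
  apply: (cone_le_lim hK (F := G) (f := fun t => Phi (l + h) (Phi t x)) _ _ Gy).
    apply: filterS (near_time_ge (t1 + s) infG) => t tt1.
    have ts0 : 0 <= t - (t1 + s) by rewrite subr_ge0.
    have t0 : 0 <= t by apply: le_trans tt1; exact: addr_ge0.
    have t1s : 0 <= t1 + s by exact: addr_ge0.
    have t1lhs : 0 <= t1 + l + h + s by rewrite !addr_ge0// ltW.
    have := hmono (Xflow t1lhs Xx) (Xflow t1s Xy) ts0 le1.
    rewrite (semiflowD hPhi ts0 t1s Xy) subrK (semiflowD hPhi ts0 t1lhs Xx).
    rewrite (semiflowD hPhi lh0 t0 Xx); congr (cone_le K (Phi _ x) _); ring.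
  by apply: (flow_cvg_point hPhi) => //; exact: GX.
- move=> l l0 H.
  apply: (cone_le_lim hK (F := l^'-) (f := fun k => Phi k p) (g := fun=> q)).
  + near=> k; apply: H; apply/andP; split.
      by near: k; exact: nbhs_left_ge.
    by near: k; exact: nbhs_left_lt.
  + apply: (flow_cvg_time hPhi) => //.
    * by apply: cvg_at_left_filter; exact: cvg_id.
    * exact: ltW.
    * exact: nbhs_left_ge.
  + exact: cvg_cst.
Unshelve. all: by end_near. Qed.

Definition backward_invariant (C : set B) :=
  C `<=` X /\ forall t c, 0 <= t -> C c -> exists2 c', C c' & Phi t c' = c.

Lemma omega_limit_backward_invariant x : X x -> backward_invariant (w x).
Proof.
move=> Xx; split; first exact: omega_limit_sub.
by move=> t c t0 wc; exact: omega_limit_backward.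
Qed.

(** By compactness a single time puts the trajectory of [z], then near [b], above all of [C] after a
    further [t1]. Backward invariance writes each point of [C] as a late image of points of [C], so
    the comparison persists at all later times. *)
Lemma absorb_below (C : set B) z b : compact C -> backward_invariant C -> X z ->
  w z b -> (forall c, C c -> cone_lt K c b) -> set_le K C (w z).
Proof.
move=> cC [CX Cback] Xz wb Cb.
have [G [GP infG Gb]] := omega_limit_filter wb; have Xb := omega_limit_sub wb.
(* Otherwise each time [t] has a bad point [c t] in [C]. A limit of these points is strictly below
   [b], and the strong order at time [t1] passes to nearby points. *)
have [t t0 Ht] : exists2 t, 0 <= t &
    forall c, C c -> cone_le K (Phi t1 c) (Phi t1 (Phi t z)).
  apply: contrapT => /forall2NP H.
  have /choice[c Hc] : forall t, exists c, 0 <= t -> C c /\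
      ~ cone_le K (Phi t1 c) (Phi t1 (Phi t z)).
    move=> t; have [t0|t0] := boolP (0 <= t); last by exists 0.
    have [//|/existsNP[c /not_implyP[Cc nc]]] := H t; by exists c.
  have [|G' [GP' GG' [c' Cc' Gc]]] := @compact_refine _ _ G _ _ c cC.
    by apply: filterS (near_time_ge 0 infG) => t /Hc[].
  have infG' : pinfty_nbhs R `<=` G' by move=> U /infG/GG'.
  have : \forall t \near G', K° (Phi t1 (Phi t z) - Phi t1 (c t)).
    apply: (filter_near_int (hstrong (CX _ Cc') Xb (Cb _ Cc') (lexx _))).
    apply: cvgB; apply: (flow_cvg_point hPhi) => //.
    - by move=> U /Gb/GG'.
    - by apply: filterS (near_time_ge 0 infG') => t t0; exact: Xflow.
    - exact: CX.
    - by apply: filterS (near_time_ge 0 infG') => t /Hc[/CX].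
  move=> /(filterI (near_time_ge 0 infG'))/filter_ex[t [t0 /cone_int_sub]].
  by have [] := Hc t t0.
move=> c d Cc wd; have [Gd [GPd infGd Gd1]] := omega_limit_filter wd.
apply: (cone_le_lim hK (F := Gd) _ (cvg_cst c) Gd1).
apply: filterS (near_time_ge (t1 + t) infGd) => s ts.
have r0 : 0 <= s - (t1 + t) by rewrite subr_ge0.
have [c1 Cc1 <-] := Cback _ _ r0 Cc; have [c2 Cc2 <-] := Cback _ _ t1_ge0 Cc1.
have Xtz := Xflow t0 Xz; have Xc2 := CX _ Cc2.
have := hmono (Xflow t1_ge0 Xc2) (Xflow t1_ge0 Xtz) r0 (Ht _ Cc2).
by rewrite (semiflowD hPhi t1_ge0 t0 Xz) (semiflowD hPhi r0 (addr_ge0 t1_ge0 t0) Xz) subrK.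
Qed.

(** The mirror image of [absorb_below], with the trajectory of [z] below [C]. *)
Lemma absorb_above (C : set B) z a : compact C -> backward_invariant C -> X z ->
  w z a -> (forall c, C c -> cone_lt K a c) -> set_le K (w z) C.
Proof.
move=> cC [CX Cback] Xz wa Ca.
have [G [GP infG Ga]] := omega_limit_filter wa; have Xa := omega_limit_sub wa.
have [t t0 Ht] : exists2 t, 0 <= t &
    forall c, C c -> cone_le K (Phi t1 (Phi t z)) (Phi t1 c).
  apply: contrapT => /forall2NP H.
  have /choice[c Hc] : forall t, exists c, 0 <= t -> C c /\
      ~ cone_le K (Phi t1 (Phi t z)) (Phi t1 c).
    move=> t; have [t0|t0] := boolP (0 <= t); last by exists 0.
    have [//|/existsNP[c /not_implyP[Cc nc]]] := H t; by exists c.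
  have [|G' [GP' GG' [c' Cc' Gc]]] := @compact_refine _ _ G _ _ c cC.
    by apply: filterS (near_time_ge 0 infG) => t /Hc[].
  have infG' : pinfty_nbhs R `<=` G' by move=> U /infG/GG'.
  have : \forall t \near G', K° (Phi t1 (c t) - Phi t1 (Phi t z)).
    apply: (filter_near_int (hstrong Xa (CX _ Cc') (Ca _ Cc') (lexx _))).
    apply: cvgB; apply: (flow_cvg_point hPhi) => //.
    - exact: CX.
    - by apply: filterS (near_time_ge 0 infG') => t /Hc[/CX].
    - by move=> U /Ga/GG'.
    - by apply: filterS (near_time_ge 0 infG') => t t0; exact: Xflow.
  move=> /(filterI (near_time_ge 0 infG'))/filter_ex[t [t0 /cone_int_sub]].
  by have [] := Hc t t0.
move=> d c wd Cc; have [Gd [GPd infGd Gd1]] := omega_limit_filter wd.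
apply: (cone_le_lim hK (F := Gd) _ Gd1 (cvg_cst c)).
apply: filterS (near_time_ge (t1 + t) infGd) => s ts.
have r0 : 0 <= s - (t1 + t) by rewrite subr_ge0.
have [c1 Cc1 <-] := Cback _ _ r0 Cc; have [c2 Cc2 <-] := Cback _ _ t1_ge0 Cc1.
have Xtz := Xflow t0 Xz; have Xc2 := CX _ Cc2.
have := hmono (Xflow t1_ge0 Xtz) (Xflow t1_ge0 Xc2) r0 (Ht _ Cc2).
by rewrite (semiflowD hPhi t1_ge0 t0 Xz) (semiflowD hPhi r0 (addr_ge0 t1_ge0 t0) Xz) subrK.
Qed.

(** A limit point [q] of [y] outside the limit set of [x] would force order: it dominates the limit
    set of some [p] in that of [x], which is absorbed below the limit set of [y], and this in turn
    pulls all limit points of [x] below. Otherwise limits taken along the same times are ordered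
    points of one limit set, so they agree. *)
Lemma limit_set_dichotomy x y : X x -> X y -> cone_lt K x y ->
  ~ set_le K (w x) (w y) ->
  [/\ w x = w y, w x `<=` equilibria X Phi &
      (fun t => Phi t y - Phi t x) @ pinfty_nbhs R --> (0 : B)].
Proof.
move=> Xx Xy xy nle.
have wyx : w y `<=` w x.
  move=> q wq; apply: contrapT => nwq; apply: nle.
  have [G [GP infG Gq]] := omega_limit_filter wq.
  have [G' [GP' GG' [p wp Gp]]] := omega_limit_refine hPhi horb Xx infG.
  have infG' : pinfty_nbhs R `<=` G' by move=> U /infG/GG'.
  have Gq' : (fun t => Phi t y) @ G' --> q by move=> U /Gq/GG'.
  have H := limit_pair_dominates Xx Xy xy.1 infG' Gp Gq' wp wq nwq.
  have Xp := omega_limit_sub wp.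
  have wpx := omega_limit_trans hPhi Xx wp.
  have wpq c : w p c -> cone_le K c q.
    move=> /omega_limit_filter[Gc [GcP infGc Gc1]].
    apply: (cone_le_lim hK (F := Gc) _ Gc1 (cvg_cst q)).
    by apply: filterS (near_time_ge 0 infGc) => l; exact: H.
  have lepy : set_le K (w p) (w y).
    apply: (absorb_below (b := q)) => //.
    - exact: omega_limit_compact.
    - exact: omega_limit_backward_invariant.
    - by move=> c wc; split; [exact: wpq|move=> cq; apply: nwq; apply: wpx; rewrite -cq].
  have [a wa] := omega_limit_neq0 hPhi horb Xp.
  apply: (absorb_above (a := a)) => //.
  - exact: omega_limit_compact.
  - exact: omega_limit_backward_invariant.
  - exact: wpx.
  - move=> c wc; split; first exact: lepy.
    move=> ac; apply: nwq; rewrite -(omega_limit_unordered Xy _ wq (wpq _ wa)).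
      exact: wpx.
    by rewrite ac.
have matched G a b : ProperFilter G -> pinfty_nbhs R `<=` G ->
    (fun t => Phi t x) @ G --> a -> (fun t => Phi t y) @ G --> b ->
    w x a -> w y b -> a = b.
  move=> GP infG Ga Gb wa wb; apply: (omega_limit_unordered Xx wa (wyx _ wb)).
  apply: (cone_le_lim hK (F := G) _ Ga Gb).
  by apply: filterS (near_time_ge 0 infG) => t t0; exact: hmono xy.1.
have wxy a : w x a -> w y a /\ equilibria X Phi a.
  move=> wa; have [G [GP infG Ga]] := omega_limit_filter wa.
  have [G' [GP' GG' [b wb Gb]]] := omega_limit_refine hPhi horb Xy infG.
  have infG' : pinfty_nbhs R `<=` G' by move=> U /infG/GG'.
  have Ga' : (fun t => Phi t x) @ G' --> a by move=> U /Ga/GG'.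
  have ab := matched G' a b GP' infG' Ga' Gb wa wb.
  split; first by rewrite ab.
  apply: (colimit_equilibrium Xx Xy xy infG' Ga'); first by rewrite ab.
  exact: omega_limit_sub wa.
split.
- by apply/seteqP; split => // a /wxy[].
- by move=> a /wxy[].
(* If the gap is at least [e] at arbitrarily late times, those times yield limits of both
   trajectories at distance at least [e], although matched limits coincide. *)
apply/cvgrPdist_lt => e e0; apply: contrapT => nlt.
pose F := within [set t : R | e <= `|Phi t y - Phi t x|] (pinfty_nbhs R).
have FP : ProperFilter F.
  apply: Build_ProperFilter => F0; apply: nlt; move: F0; rewrite /F /within /=.
  by apply: filterS => t /= Ht; rewrite sub0r normrN ltNge; exact/negP.
have infF : pinfty_nbhs R `<=` F by move=> U; apply: filterS => t Ut _.
have [G [GP FG [a wa Ga]]] := omega_limit_refine hPhi horb Xx infF.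
have infG : pinfty_nbhs R `<=` G by move=> U /infF/FG.
have [G' [GP' GG' [b wb Gb]]] := omega_limit_refine hPhi horb Xy infG.
have infG' : pinfty_nbhs R `<=` G' by move=> U /infG/GG'.
have Ga' : (fun t => Phi t x) @ G' --> a by move=> U /Ga/GG'.
have ab := matched G' a b GP' infG' Ga' Gb wa wb.
have : `|b - a| >= e.
  have H : (fun t => `|Phi t y - Phi t x|) @ G' --> `|b - a|.
    by apply: cvg_norm; exact: cvgB.
  apply: (closed_cvg (fun r : R => e <= r) (@closed_ge _ e) _ _ H).
  by apply: GG'; apply: FG; rewrite /F /within /=; apply: filterE.
by rewrite ab subrr normr0 leNgt e0.
Qed.

End MonotoneFlow.

(** * Linear instability *)

Lemma expr_unbounded {R : realType} (r M : R) : 1 < r -> exists n : nat, M <= r ^+ n.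
Proof.
move=> r1; have r0 : 0 < r by exact: lt_trans r1.
have M1 : 0 < 1 + `|M| by rewrite ltr_pwDl.
have : `|r^-1| < 1 by rewrite ger0_norm ?invr_ge0 ?(ltW r0)// invf_lt1.
move=> /cvg_expr/cvgrPdist_lt/(_ (1 + `|M|)^-1).
rewrite invr_gt0 => /(_ M1)/filter_ex[n]; rewrite sub0r normrN => H.
exists n; move: H; rewrite ger0_norm ?exprn_ge0 ?invr_ge0 ?(ltW r0)//.
rewrite exprVn ltf_pV2 ?posrE ?exprn_gt0// => H.
apply: (le_trans (ler_norm M)); apply: (le_trans _ (ltW H)).
by rewrite lerDr.
Qed.

Section Instability.
Context {R : realType} {B : normedModType R}.
Variables (K X : set B) (Phi : R -> B -> B) (t0 t1 : R).
Hypothesis hK : order_cone K.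
Hypothesis hKint : K° !=set0.
Hypothesis hPhi : semiflow X Phi.
Hypothesis huniq : unique_derivatives X Phi.
Hypothesis t0_ge0 : 0 <= t0.
Hypothesis hC1 : forall t, t0 <= t -> C1_on X (Phi t).
Hypothesis hdcpt : forall t, t0 <= t -> compact_derivatives X (Phi t).
Hypothesis horb : forall x, X x -> compact (orbit_closure X Phi x).
Hypothesis hoX : order_convex K X.
Hypothesis hirr : forall e, equilibria X Phi e ->
  irreducible_equilibrium K X Phi e.
Hypothesis hmono : monotone_flow K X Phi.
Hypothesis t1_ge0 : 0 <= t1.
Hypothesis hstrong : forall x y t, X x -> X y -> cone_lt K x y -> t1 <= t ->
  cone_ll K (Phi t x) (Phi t y).
Implicit Types (x y z a b c p q e : B) (L : {linear B -> B}).

Let w := omega_limit X Phi.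
Let Xflow t x : 0 <= t -> X x -> X (Phi t x).
Proof. by move=> s0 Xx; apply: (semiflow_stable hPhi). Qed.

Lemma derivative_iter e (T : R) L n : X e -> Phi T e = e -> 0 <= T ->
  is_frechet X (Phi T) e L ->
  exists M : {linear B -> B}, is_frechet X (Phi (T *+ n.+1)) e M /\
    forall v, M v = iter n.+1 L v.
Proof.
move=> Xe eT T0 fL; elim: n => [|n [M [fM HM]]].
  by exists L; split => //; rewrite mulr1n.
have Tn : 0 <= T *+ n.+1 by exact: mulrn_wge0.
exists (L \o M); split; last by move=> v; rewrite [LHS]/= HM.
apply: (frechet_ext (f := Phi T \o Phi (T *+ n.+1)) (L := L \o M)) => //.
  by move=> y Xy; rewrite /= (semiflowD hPhi)// -mulrS.
apply: frechet_comp => //; first by move=> y; exact: Xflow.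
by rewrite (flow_iter_fixed hPhi).
Qed.

(** The approximation condition of [frechet_pos]; only the lower point [p] has to approach [e]. *)
Let near_ll e := forall d : R, 0 < d -> exists p q,
  [/\ X p, X q, cone_ll K p q & `|p - e| < d].

Lemma strict_positive_derivative e (T : R) : X e -> near_ll e -> t0 <= T ->
  exists L, [/\ is_frechet X (Phi T) e L, forall h, K h -> K (L h) &
    forall r : R, 0 < r -> exists2 d : R, 0 < d &
    forall p q, `|p - e| < d -> `|q - e| < d ->
      (forall t : R, 0 <= t <= 1 -> X (p + t *: (q - p))) ->
      `|Phi T q - Phi T p - L (q - p)| <= r * `|q - p|].
Proof.
move=> Xe elle tT; have [u Ku] := hKint.
have [L [fL Ls]] := C1_strict Xe (hC1 tT).
exists L; split => //; apply: (frechet_pos hK Ku hoX _ Ls elle).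
by move=> p q Xp Xq; apply: hmono => //; exact: le_trans tT.
Qed.

Lemma derivative_compact e (T : R) L : X e -> t0 <= T ->
  is_frechet X (Phi T) e L -> continuous L /\ compact_linear L.
Proof.
by move=> Xe tT fL; split; [case: fL|apply: compact_on_linear; exact: hdcpt fL].
Qed.

(** The irreducibility time may be smaller than [t0]. A multiple of it exceeds [t0], and there the
    derivative is a power of a strongly positive operator. *)
Lemma strongly_positive_derivative e : equilibria X Phi e -> exists T P,
  [/\ t0 <= T, is_frechet X (Phi T) e P & strongly_positive K P].
Proof.
move=> Ee; have [Xe eE] := Ee; have [t [L [tgt0 fL Lpos]]] := hirr Ee.
have [k Hk] : exists k : nat, t0 <= t *+ k.+1.
  have t01 : 0 < 1 + t0 by rewrite ltr_pwDl.
  have /filter_ex[k /=] := near_infty_natSinv_lt (PosNum (divr_gt0 tgt0 t01)).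
  rewrite ltr_pdivlMr// mulrC ltr_pdivrMr// mulr_natr => H.
  by exists k; apply: le_trans (ltW H); rewrite lerDr.
have [P [fP HP]] := derivative_iter k Xe (eE _ (ltW tgt0)) (ltW tgt0) fL.
exists (t *+ k.+1), P; split => // x x0.
rewrite HP; elim: k {Hk fP HP P} => [|k IH]; first exact: Lpos.
apply: Lpos; apply: (cone_int_gt0 hK).
by move: IH; rewrite /cone_ll subr0.
Qed.

Let unstable e := exists (T : R) L v (r : R),
  [/\ t0 <= T, is_frechet X (Phi T) e L, K° v & 1 < r /\ L v = r *: v].

(** With [k v <= u] and [k' u <= v], enough iterates of the unstable eigenvalue make the derivative
    [D] satisfy [2 u <= D u]. The strict differentiability error costs at most half of [u], which
    leaves the factor 3/2. *)
Lemma local_expansion e u : K° u -> equilibria X Phi e -> near_ll e ->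
  unstable e -> exists2 S : R, 0 <= S & exists2 d : R, 0 < d &
    forall z (c : R), 0 < c -> X z -> X (z + c *: u) -> `|z - e| < d ->
      `|c *: u| < d ->
      K (Phi S (z + c *: u) - Phi S z - (c * (3 / 2)) *: u).
Proof.
move=> Ku [Xe eE] elle [T [L [v [r [tT fL Kv [r1 Lv]]]]]].
have [k k0 Kuv] := cone_int_absorb v Ku.
have [k' k'0 Kvu] := cone_int_absorb u Kv.
have [n Hn] := expr_unbounded (2 / (k * k')) r1.
have T0 : 0 <= T by exact: le_trans tT.
have [M [fM HM]] := derivative_iter n Xe (eE _ T0) T0 fL.
pose S := T *+ n.+1.
have S0 : 0 <= S by exact: mulrn_wge0.
have tS : t0 <= S by apply: (le_trans tT); rewrite /S mulrS lerDl mulrn_wge0.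
have [D [fD Dpos Ds]] := strict_positive_derivative Xe elle tS.
have DM := huniq S0 Xe fD fM.
have r0 : 0 < r by exact: lt_trans r1.
have Dv : D v = r ^+ n.+1 *: v.
  rewrite DM HM; elim: (n.+1) => [|m IH] /=; first by rewrite scale1r.
  by rewrite IH linearZ /= Lv scalerA -exprSr.
have KDu : K (D u - 2 *: u).
  have -> : D u - 2 *: u = D (u - k *: v) + (k * r ^+ n.+1) *: (v - k' *: u) +
      (k * r ^+ n.+1 * k' - 2) *: u.
    have -> : D (u - k *: v) = D u - (k * r ^+ n.+1) *: v.
      by rewrite linearB linearZ /= Dv scalerA.
    by rewrite scalerBr addrA subrK !scalerA scalerBl addrA subrK.
  apply: (order_coneD hK).
    apply: (order_coneD hK); first exact: Dpos.
    by apply: (order_coneZ hK) => //; rewrite mulr_ge0 ?exprn_ge0// ltW.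
  apply: (order_coneZ hK); last exact: cone_int_sub.
  rewrite subr_ge0 mulrAC mulrC -ler_pdivrMr ?mulr_gt0//.
  by apply: (le_trans Hn); rewrite exprS ler_peMl ?exprn_ge0// ltW.
have [e1 e10 He1] := (cone_intP K u).1 Ku.
have u1 : 0 < 2 * (1 + `|u|) by rewrite mulr_gt0// ltr_pwDl.
have [d d0 Hd] := Ds (e1 / (2 * (1 + `|u|))) (divr_gt0 e10 u1).
exists S => //; exists (d / 2); first by rewrite divr_gt0.
move=> z c c0 Xz Xzc ze cd.
have d2 : d / 2 < d by rewrite ltr_pdivrMr// mulr_natr mulr2n ltrDl.
have zcz : z + c *: u - z = c *: u by rewrite addrC addKr.
have Ku' := cone_int_sub Ku.
have := Hd z (z + c *: u) (lt_trans ze d2); rewrite zcz => H.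
have {}H : `|Phi S (z + c *: u) - Phi S z - D (c *: u)| <=
    e1 / (2 * (1 + `|u|)) * `|c *: u|.
  apply: H.
    rewrite addrAC; apply: (le_lt_trans (ler_normD _ _)).
    by rewrite [d]splitr ltrD.
  move=> t /andP[tge0 tle1]; apply: (hoX Xz Xzc); rewrite /cone_le.
    rewrite addrC addKr scalerA; apply: (order_coneZ hK) => //.
    by rewrite mulr_ge0// ltW.
  rewrite opprD addrACA subrr add0r scalerA -scalerBl; apply: (order_coneZ hK) => //.
  by rewrite subr_ge0 ler_piMl// ltW.
have [W WE {}H] : exists2 W, Phi S (z + c *: u) - Phi S z = c *: D u + W &
    `|W| <= e1 / (2 * (1 + `|u|)) * `|c *: u|.
  by eexists; [|exact: H]; rewrite linearZ /= [RHS]addrC subrK.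
have -> : Phi S (z + c *: u) - Phi S z - (c * (3 / 2)) *: u =
    c *: (D u - 2 *: u) + (c / 2) *: (u + (2 / c) *: W).
  rewrite WE scalerBr scalerDr !scalerA (_ : c / 2 * (2 / c) = 1); last first.
    by field; rewrite gt_eqF.
  rewrite scale1r -!addrA; congr (_ + _); rewrite [RHS]addrA [LHS]addrC.
  by congr (_ + _); rewrite [RHS]addrC -scalerBl -[LHS]scaleNr; congr (_ *: _); field.
apply: (order_coneD hK); apply: (order_coneZ hK) => //; first exact: ltW.
  by rewrite divr_ge0// ltW.
apply: He1; rewrite normrZ gtr0_norm ?divr_gt0//.
rewrite -ler_pdivlMl ?divr_gt0//; apply: (le_trans H).
rewrite normrZ gtr0_norm//.
have -> : e1 / (2 * (1 + `|u|)) * (c * `|u|) = (2 / c)^-1 * e1 * (`|u| / (1 + `|u|)).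
  by field; rewrite gt_eqF// gt_eqF// ltr_pwDl.
rewrite ler_piMr ?mulr_ge0 ?invr_ge0 ?divr_ge0 ?(ltW c0) ?(ltW e10)//.
by rewrite ler_pdivrMr ?ltr_pwDl// mul1r lerDr.
Qed.

Lemma omega_limit_near_ll x y e : X x -> X y -> cone_lt K x y -> w x e -> near_ll e.
Proof.
move=> Xx Xy xy /omega_limit_filter[G [GP infG Ge]] r r0.
have [t [tt1 te]] : exists t, t1 <= t /\ `|Phi t x - e| < r.
  apply: (@filter_ex _ G); apply: filterI; first exact: near_time_ge.
  by have /cvgrPdist_lt/(_ _ r0) := Ge; apply: filterS => t; rewrite distrC.
have tge0 : 0 <= t by exact: le_trans tt1.
by exists (Phi t x), (Phi t y); split => //; [exact: Xflow|exact: Xflow|exact: hstrong].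
Qed.

(* Along the pair the gap [Phi t y - Phi t x] dominates [c *: u] with [c]
   growing geometrically, whereas it tends to 0. *)
Lemma unstable_pair_false x y : X x -> X y -> cone_lt K x y ->
  (fun t => Phi t y - Phi t x) @ pinfty_nbhs R --> (0 : B) ->
  (forall e, w x e -> equilibria X Phi e /\ unstable e) -> False.
Proof.
move=> Xx Xy xy d0 wE; have [u Ku] := hKint; have Ku' := cone_int_sub Ku.
pose d t := Phi t y - Phi t x.
(* At a good time every lower bound [c *: u] of the gap gains the factor 3/2 after a delay [S] that
   may depend on [t]. *)
pose good t := exists2 S : R, 0 <= S & forall c : R, 0 < c ->
  K (d t - c *: u) -> K (d (t + S) - (c * (3 / 2)) *: u).
have small (eta : R) : 0 < eta -> \forall t \near pinfty_nbhs R, K° (eta *: u - d t).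
  move=> eta0; apply: (filter_near_int (cone_intZ hK eta0 Ku)).
  by rewrite -[X in _ --> X]subr0; apply: cvgB => //; exact: cvg_cst.
have small_lt t (c eta : R) : K° (eta *: u - d t) -> K (d t - c *: u) -> c < eta.
  move=> H1 H2; rewrite ltNge; apply/negP => etac.
  have : K° (eta *: u - d t + (d t - c *: u) + (c - eta) *: u).
    apply: (cone_intDl hK); first exact: (cone_intDl hK).
    by apply: (order_coneZ hK) => //; rewrite subr_ge0.
  rewrite addrA subrK -scalerBl -scalerDl.
  rewrite (_ : _ + _ = 0) ?scale0r; first exact: cone_int_neq0.
  by ring.
(* Bad times arbitrarily late would bring the trajectory of [x] near some limit point [e], where
   [local_expansion] applies as soon as the gap is small; order convexity puts [Phi t x + c *: u] in
   [X]. *)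
have near_good : \forall t \near pinfty_nbhs R, good t.
  apply: contrapT => ngood.
  pose F := within [set t | ~ good t] (pinfty_nbhs R).
  have FP : ProperFilter F.
    apply: Build_ProperFilter => F0; apply: ngood; move: F0; rewrite /F /within /=.
    by apply: filterS => t /= Ht; apply: contrapT.
  have infF : pinfty_nbhs R `<=` F by move=> U; apply: filterS => t Ut _.
  have [G [GP FG [e we Ge]]] := omega_limit_refine hPhi horb Xx infF.
  have infG : pinfty_nbhs R `<=` G by move=> U /infF/FG.
  have [Ee ue] := wE _ we; have Xe := Ee.1.
  have elle := omega_limit_near_ll Xx Xy xy we.
  have [S S0 [r r0 HS]] := local_expansion Ku Ee elle ue.
  have u1 : 0 < 1 + `|u| by rewrite ltr_pwDl.
  pose eta := r / (1 + `|u|).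
  have eta0 : 0 < eta by rewrite divr_gt0.
  have : \forall t \near G, [/\ 0 <= t, `|Phi t x - e| < r, K° (eta *: u - d t) & ~ good t].
    have H1 := near_time_ge 0 infG; have H2 := infG _ (small _ eta0).
    have H3 : \forall t \near G, `|Phi t x - e| < r.
      by have /cvgrPdist_lt/(_ _ r0) := Ge; apply: filterS => t; rewrite distrC.
    have H4 : \forall t \near G, ~ good t.
      by apply: FG; rewrite /F /within /=; apply: filterE.
    by near=> t; split; near: t.
  move=> /filter_ex[t [tge0 te Kt]]; apply; exists S => // c c0 Kc.
  have ceta := small_lt _ _ _ Kt Kc.
  have Xtx := Xflow tge0 Xx; have Xty := Xflow tge0 Xy.
  have Xc : X (Phi t x + c *: u).
    apply: (hoX Xtx Xty); rewrite /cone_le; last by rewrite opprD addrA.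
    by rewrite addrC addKr; apply: (order_coneZ hK) => //; exact: ltW.
  have cu : `|c *: u| < r.
    rewrite normrZ gtr0_norm//; apply: (@le_lt_trans _ _ (eta * `|u|)).
      by rewrite ler_wpM2r// ltW.
    by rewrite /eta mulrAC ltr_pdivrMr// ltr_pM2l// ltrDr.
  have := HS _ _ c0 Xtx Xc te cu; rewrite (semiflowD hPhi)// => H.
  have H' : cone_le K (Phi S (Phi t x + c *: u)) (Phi S (Phi t y)).
    by apply: hmono => //; rewrite /cone_le opprD addrA.
  have := order_coneD hK H' H; rewrite (semiflowD hPhi)// /d [t + S]addrC.
  by rewrite !addrA subrK.
have : \forall t \near pinfty_nbhs R, [/\ t1 <= t, good t & K° (1 *: u - d t)].
  have H1 := near_time_ge t1 (@subset_refl _ (pinfty_nbhs R)).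
  have H2 := small _ ltr01.
  by near=> t; split; near: t.
move=> [T [_ HT]].
have {}HT t : T + 1 <= t -> [/\ t1 <= t, good t & K° (1 *: u - d t)].
  by move=> Tt; apply: HT; apply: lt_le_trans Tt; rewrite ltrDl.
have [tT1 _ _] := HT _ (lexx _).
have [c0 c00 Hc0] := cone_int_absorb u (hstrong Xx Xy xy tT1).
have grow n : exists2 t, T + 1 <= t & K (d t - (c0 * (3 / 2) ^+ n) *: u).
  elim: n => [|n [t Tt Ht]]; first by exists (T + 1); rewrite ?mulr1.
  have [_ [S S0 HS] _] := HT _ Tt; exists (t + S).
    by apply: (le_trans Tt); rewrite lerDl.
  have -> : c0 * (3 / 2) ^+ n.+1 = c0 * (3 / 2) ^+ n * (3 / 2).
    by rewrite exprSr; ring.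
  apply: HS => //.
  by rewrite mulr_gt0 ?exprn_gt0// divr_gt0.
have [|n Hn] := @expr_unbounded R (3 / 2) c0^-1; first by rewrite ltr_pdivlMr// mul1r ltr_nat.
have [t Tt Ht] := grow n; have [_ _ Kt] := HT _ Tt.
have := small_lt _ _ _ Kt Ht; rewrite ltNge -(ler_pM2l (x := c0^-1)) ?invr_gt0//.
by rewrite mulKf ?gt_eqF// mulr1 Hn.
Unshelve. all: by end_near. Qed.


Lemma principal_eigenpair e : equilibria X Phi e -> exists (T : R) P v (r : R),
  [/\ t0 <= T, is_frechet X (Phi T) e P, strongly_positive K P &
   [/\ 0 < r, K° v & P v = r *: v]].
Proof.
move=> Ee; have [T [P [tT fP Ppos]]] := strongly_positive_derivative Ee.
have [Pc Pcpt] := derivative_compact Ee.1 tT fP.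
have [r r0 [v Kv Pv]] := krein_rutman hK Ppos Pc Pcpt hKint.
by exists T, P, v, r.
Qed.

(** Between late visits near [a] and near [b], the distance to [a] crosses the value [d]; the
    crossing points accumulate. Hence a limit set with two points has no isolated point. *)
Lemma omega_limit_sphere x a b (d : R) : X x -> w x a -> w x b -> 0 < d ->
  d < `|b - a| -> exists2 p, w x p & `|p - a| = d.
Proof.
move=> Xx wa wb d0 dab.
pose g t := `|Phi t x - a|.
have [Ga [GaP infGa Ga1]] := omega_limit_filter wa.
have [Gb [GbP infGb Gb1]] := omega_limit_filter wb.
have cross M : 0 <= M -> exists2 t, M <= t & g t = d.
  move=> M0.
  have [s1 [Ms1 gs1]] : exists t, M <= t /\ g t < d.
    apply: (@filter_ex _ Ga); apply: filterI; first exact: near_time_ge.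
    by have /cvgrPdist_lt/(_ _ d0) := Ga1; apply: filterS => t; rewrite distrC.
  have [s2 [s12 gs2]] : exists t, s1 <= t /\ d < g t.
    apply: (@filter_ex _ Gb); apply: filterI; first exact: near_time_ge.
    have : (fun t => g t) @ Gb --> `|b - a|.
      by apply: cvg_norm; apply: cvgB => //; exact: cvg_cst.
    by move=> /cvgr_gt; apply.
  have [||t] := @IVT R g s1 s2 d s12.
  - apply/subspace_continuousP => s; rewrite /= in_itv /= => /andP[s1s _].
    apply: cvg_norm; apply: cvgB; last exact: cvg_cst.
    have s0 : 0 <= s by apply: le_trans s1s; exact: le_trans Ms1.
    apply: (flow_cvg_time hPhi) => //.
      exact: cvg_within_filter.
    rewrite near_withinE; apply: nearW => r; rewrite /= in_itv /= => /andP[s1r _].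
    by apply: le_trans s1r; exact: le_trans Ms1.
  - by rewrite ge_min (ltW gs1)/= le_max (ltW gs2) orbT.
  by rewrite in_itv /= => /andP[s1t _] gt; exists t => //; exact: le_trans s1t.
pose F := within [set t | g t = d] (pinfty_nbhs R).
have FP : ProperFilter F.
  apply: Build_ProperFilter => -[M [_ HM]].
  have [|t Mt gt] := cross (Num.max 0 (M + 1)); first by rewrite le_max lexx.
  apply: (HM t _ gt); move: Mt; rewrite ge_max => /andP[_].
  by apply: lt_le_trans; rewrite ltrDl.
have infF : pinfty_nbhs R `<=` F by move=> U; apply: filterS => t Ut _.
have [G [GP FG [p wp Gp]]] := omega_limit_refine hPhi horb Xx infF.
exists p => //.
have H : g @ G --> `|p - a|.
  by apply: cvg_norm; apply: cvgB => //; exact: cvg_cst.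
apply: (norm_cvg_unique H); apply: cvg_near_cst.
by apply: FG; rewrite /F /within /=; apply: filterE.
Qed.

(** With two limit points, each [e] in the limit set is approached by other equilibria of the set.
    The limiting direction is fixed by the strongly positive [P] and lies outside the cone and its
    opposite, so [principal_eigenvalue_gt1] makes every [e] unstable, against
    [unstable_pair_false]. *)
Lemma omega_limit_common_single x y a b : X x -> X y -> cone_lt K x y ->
  w x `<=` equilibria X Phi ->
  (fun t => Phi t y - Phi t x) @ pinfty_nbhs R --> (0 : B) ->
  w x a -> w x b -> a = b.
Proof.
move=> Xx Xy xy wE xy0 wa wb; apply: contrapT => ab.
apply: (unstable_pair_false Xx Xy xy xy0) => e we; split; first exact: wE.
have Ee := wE _ we; have Xe := Ee.1.
have [c [wc ce]] : exists c, w x c /\ c <> e.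
  have [ae|ae] := pselect (a = e); last by exists a.
  by exists b; split => // be; apply: ab; rewrite ae be.
have [T [P [v [r [tT fP Ppos [r0 Kv Pv]]]]]] := principal_eigenpair Ee.
exists T, P, v, r; split => //; split => //.
have [Pc Pcpt] := derivative_compact Xe tT fP.
have T0 : 0 <= T by exact: le_trans tT.
have eT : Phi T e = e by exact: Ee.2.
have wT p : w x p -> X p /\ Phi T p = p by move=> /wE[Xp pE]; split => //; exact: pE.
have [d d0|G [GP Ge GA [z z1 Gz]]] := direction_limit Pcpt fP eT wT.
  have ce0 : 0 < `|c - e| by rewrite normr_gt0 subr_eq0; exact/eqP.
  pose d' := Num.min d (`|c - e|) / 2.
  have m0 : 0 < Num.min d `|c - e| by rewrite lt_min d0.
  have d'0 : 0 < d' by rewrite divr_gt0.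
  have d'm : d' < Num.min d `|c - e| by rewrite ltr_pdivrMr// mulr_natr mulr2n ltrDl.
  have [|p wp pe] := @omega_limit_sphere x e c d' Xx we wc d'0.
    by apply: (lt_le_trans d'm); rewrite ge_min lexx orbT.
  exists p; split => //; last by rewrite pe; apply: (lt_le_trans d'm); rewrite ge_min lexx.
  by move=> pe0; move: d'0; rewrite -pe pe0 subrr normr0 ltxx.
have Pz : P z = z.
  apply: (fixed_direction fP eT Ge _ Gz).
  by apply: filterS GA => p [/wT[]].
have z0 : z <> 0 by move=> z0; move/eqP: z1; rewrite z0 normr0 eq_sym oner_eq0.
have scale p : p <> e -> 0 < `|p - e|.
  by move=> pe; rewrite normr_gt0 subr_eq0; exact/eqP.
have dirE p : p <> e -> p - e = `|p - e| *: direction e p.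
  by move=> /scale n0; rewrite /direction scalerA divff ?gt_eqF// scale1r.
apply: (principal_eigenvalue_gt1 hK Ppos Kv Pv Pz).
(* If [z] were in the cone, [z = P z] would be interior, and nearby directions would order [e] with
   another point of the limit set. *)
- move=> Kz; have := strongly_positive_int Ppos Kz z0; rewrite Pz => Kz'.
  have [p [Kp [wp pe]]] : exists p, K (direction e p) /\ w x p /\ p <> e.
    apply: (@filter_ex _ G); apply: filterI; last exact: GA.
    by apply: filterS (filter_near_int Kz' Gz) => p /cone_int_sub.
  apply: (pe); apply/esym.
  apply: (omega_limit_unordered hK hPhi hmono t1_ge0 hstrong Xx we wp).
  by rewrite /cone_le (dirE p)//; apply: (order_coneZ hK).
- move=> Kz; have : - z <> 0 by move=> /eqP; rewrite oppr_eq0 => /eqP.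
  move=> /(strongly_positive_int Ppos Kz); rewrite linearN Pz => Kz'.
  have [p [Kp [wp pe]]] : exists p, K (- direction e p) /\ w x p /\ p <> e.
    apply: (@filter_ex _ G); apply: filterI; last exact: GA.
    by apply: filterS (filter_near_int Kz' (cvgN Gz)) => p /cone_int_sub.
  apply: (pe).
  apply: (omega_limit_unordered hK hPhi hmono t1_ge0 hstrong Xx wp we).
  by rewrite /cone_le -opprB (dirE p)// -scalerN; apply: (order_coneZ hK).
Qed.

Lemma stable_of_eigenvector e L v (s : R) : equilibria X Phi e -> near_ll e ->
  is_frechet X (Phi t0) e L -> K° v -> 0 <= s -> s <= 1 -> L v = s *: v ->
  stable_equilibria X Phi t0 e.
Proof.
move=> Ee elle fL Kv s0 s1 Lv; split => //; exists L => //.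
have [Lc Lcpt] := derivative_compact Ee.1 (lexx _) fL.
have [D [fD Dpos _]] := strict_positive_derivative Ee.1 elle (lexx _).
apply: (@le_trans _ _ s%:E); last by rewrite lee_fin.
apply: (spectral_radius_le hK Lc Lcpt _ Kv s0).
  by move=> h Kh; rewrite (huniq t0_ge0 Ee.1 fL fD); exact: Dpos.
by rewrite Lv subrr; exact: order_cone0 hK.
Qed.

(** The strongly positive derivative [P] lives at a time [T], whereas stability is measured at [t0].
    The derivative [A] at [t0] commutes with [P], so it preserves the principal eigenvector [v] up
    to a factor [s >= 0]. A factor above 1 would contradict [unstable_pair_false]. *)
Lemma stable_of_common_limit x y e : X x -> X y -> cone_lt K x y ->
  w x = [set e] -> (fun t => Phi t y - Phi t x) @ pinfty_nbhs R --> (0 : B) ->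
  stable_equilibria X Phi t0 e.
Proof.
move=> Xx Xy xy wxe xy0.
have Ee : equilibria X Phi e by exact: (equilibrium_omega_limit hPhi Xx wxe).
have [Xe eE] := Ee.
have elle : near_ll e by apply: (omega_limit_near_ll Xx Xy xy); rewrite wxe.
have [T [P [v [r [tT fP Ppos [r0 Kv Pv]]]]]] := principal_eigenpair Ee.
have T0 : 0 <= T by exact: le_trans tT.
have [A [fA Apos _]] := strict_positive_derivative Xe elle (lexx _).
have commute z : P (A z) = A (P z).
  have PA : is_frechet X (Phi (T + t0)) e (P \o A).
    apply: (frechet_ext (f := Phi T \o Phi t0) (L := P \o A)) => //.
      by move=> z' Xz; rewrite /= (semiflowD hPhi).
    apply: frechet_comp => //; first by move=> z' Xz; exact: Xflow.
    by rewrite eE.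
  have AP : is_frechet X (Phi (T + t0)) e (A \o P).
    apply: (frechet_ext (f := Phi t0 \o Phi T) (L := A \o P)) => //.
      by move=> z' Xz; rewrite /= (semiflowD hPhi)// addrC.
    apply: frechet_comp => //; first by move=> z' Xz; exact: Xflow.
    by rewrite eE.
  exact: (huniq (addr_ge0 T0 t0_ge0) Xe PA AP z).
have PAv : P (A v) = r *: A v by rewrite commute Pv linearZ.
have KAv := Apos _ (cone_int_sub Kv).
have [Av0|Av0] := pselect (A v = 0).
  by apply: (stable_of_eigenvector Ee elle fA Kv (lexx 0)) => //; rewrite scale0r.
have [s s0 Av] := principal_eigenvector_unique hK Ppos Kv Pv KAv Av0 PAv.
have [s1|s1] := leP s 1.
  exact: (stable_of_eigenvector Ee elle fA Kv (ltW s0) s1 Av).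
exfalso; apply: (unstable_pair_false Xx Xy xy xy0) => e'.
rewrite wxe => -> /=; split => //.
by exists t0, A, v, s.
Qed.

(** Comparable equilibria accumulating at [e] have a limiting direction in the cone or its opposite,
    fixed by the derivatives at all times. Strong positivity at time [T] makes it interior up to
    sign, so it is a positive eigenvector for 1 at time [t0] and bounds the spectral radius. *)
Lemma stable_of_chain e (A : set B) : equilibria X Phi e ->
  A `<=` equilibria X Phi ->
  (forall a, A a -> cone_le K e a \/ cone_le K a e) ->
  (forall d : R, 0 < d -> exists a, [/\ A a, a <> e & `|a - e| < d]) ->
  stable_equilibria X Phi t0 e.
Proof.
move=> Ee AE Ae HA; have [Xe eE] := Ee.
(* Distinct ordered equilibria are strongly ordered, being fixed by [Phi t1]. *)
have elle : near_ll e.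
  move=> d /HA[a [Aa ae ad]]; have [Xa aE] := AE _ Aa.
  have ll p q : equilibria X Phi p -> equilibria X Phi q -> cone_le K p q -> p <> q ->
      cone_ll K p q.
    move=> [Xp pE] [Xq qE] pq npq; rewrite -(pE _ t1_ge0) -(qE _ t1_ge0).
    exact: hstrong.
  have [le_ea|le_ae] := Ae _ Aa.
    exists e, a; split => //; first by apply: (ll _ _ Ee (AE _ Aa) le_ea); exact: nesym.
    by rewrite subrr normr0; exact: le_lt_trans ad.
  by exists a, e; split => //; exact: (ll _ _ (AE _ Aa) Ee le_ae ae).
have [L [fL Lpos _]] := strict_positive_derivative Xe elle (lexx _).
have [Lc Lcpt] := derivative_compact Xe (lexx _) fL.
have AT t a : 0 <= t -> A a -> X a /\ Phi t a = a.
  by move=> tge0 /AE[Xa aE]; split => //; exact: aE.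
have [G [GP Ge GA [z z1 Gz]]] := direction_limit Lcpt fL (eE _ t0_ge0)
  (fun a => AT t0 a t0_ge0) HA.
have z0 : z <> 0 by move=> z0; move/eqP: z1; rewrite z0 normr0 eq_sym oner_eq0.
have [T [P [tT fP Ppos]]] := strongly_positive_derivative Ee.
have T0 : 0 <= T by exact: le_trans tT.
have fixT t M : 0 <= t -> is_frechet X (Phi t) e M -> M z = z.
  move=> tge0 fM; apply: (fixed_direction fM (eE _ tge0) Ge _ Gz).
  by apply: filterS GA => a [/(AT t a tge0)[]].
have Lz := fixT _ _ t0_ge0 fL; have Pz := fixT _ _ T0 fP.
have Kz : K z \/ K (- z).
  have cl : closed (K `|` -%R @^-1` K).
    apply: closedU; first exact: order_cone_closed hK.
    apply: preimage_closed; [by move=> x _; exact: opp_continuous|exact: order_cone_closed hK].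
  apply: (closed_cvg _ cl _ _ Gz); apply: filterS GA => a [Aa ae].
  have n0 : 0 <= `|a - e|^-1 by rewrite invr_ge0.
  have [H|H] := Ae _ Aa; [left|right]; first exact: (order_coneZ hK).
  by rewrite /= /direction -scalerN opprB; exact: (order_coneZ hK).
have [v Kv [Lv Pv]] : exists2 v, K v /\ v <> 0 & L v = v /\ P v = v.
  case: Kz => Kz; [by exists z|exists (- z); last by rewrite !linearN Lz Pz].
  by split => // /eqP; rewrite oppr_eq0 => /eqP.
apply: (stable_of_eigenvector Ee elle fL _ ler01 (lexx _)); last first.
  by rewrite scale1r; exact: Lv.
by rewrite -Pv; apply: (strongly_positive_int Ppos); case: Kv.
Qed.

End Instability.

(** * Shy sets *)

Section ShyLine.
Context {R : realType} {B : normedModType R}.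

Lemma uniform_prob_countable (A : set R) : measurable (A : set (measurableTypeR R)) ->
  countable (A `&` `[0, 1]) -> uniform_prob (@ltr01 R) A = 0%E.
Proof.
move=> mA cA; rewrite /uniform_prob integral_uniform_pdf.
apply: (dominates_uniform_prob (ltr01 : (0 : R) < 1) (t := A `&` `[0, 1])) => //.
  move=> C mC CA; apply: countable_lebesgue_measure0.
  exact: sub_countable (subset_card_le CA) cA.
exact: measurableI.
Qed.

(** The witness is the image of the uniform law on [[0, 1]] under [s] to [s v], for which countable
    sets of parameters are null. *)
Lemma shy_of_countable_lines (W : set B) v : v != 0 ->
  (forall y, countable [set s : R | W (y + s *: v)]) -> shy W.
Proof.
move=> v0 cW; pose phi (s : R) : borel_type := s *: v.
have phic : continuous (fun s : R => s *: v).
  by move=> s; apply: cvgZl; exact: cvg_id.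
have phi_inj s t : s *: v = t *: v -> s = t.
  move=> /eqP; rewrite -subr_eq0 -scalerBl scaler_eq0 (negbTE v0) orbF subr_eq0.
  by move/eqP.
have openm (U : set B) : open U -> measurable (U : set borel_type).
  by move=> oU; exact: sub_sigma_algebra.
have closedm (U : set B) : closed U -> measurable (U : set borel_type).
  move=> cU; rewrite -[U]setCK; apply: measurableC; apply: openm.
  exact: closed_openC.
have mphi : measurable_fun (setT : set (measurableTypeR R)) phi.
  apply: (@measurability _ _ (measurableTypeR R) borel_type setT phi (@open B)) => //.
  move=> _ [U oU <-]; rewrite setTI.
  apply: measurable_realfun.open_measurable.
  by move/continuousP : phic; exact.
pose X : {mfun (measurableTypeR R) >-> borel_type} :=
  @mfun_Sub _ _ (measurableTypeR R) borel_type phi (mem_set mphi).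
pose C := (fun s : R => s *: v) @` `[0, 1].
have cC : compact C.
  apply: continuous_compact; last exact: segment_compact.
  exact: continuous_subspaceT.
have mC : measurable (~` C : set borel_type).
  by apply: measurableC; apply: closedm; exact: compact_closed.
exists (distribution (uniform_prob (@ltr01 R)) X); split.
- move=> mu0; have : 1%E = 0%E :> \bar R.
    by rewrite -mu0; apply/esym; exact: probability_setT.
  by move/eqP; rewrite onee_eq0.
- exists C => //.
  rewrite /distribution /pushforward; apply: uniform_prob_countable.
    rewrite -[X in measurable X]setTI; exact: (mphi measurableT _ mC).
  rewrite (_ : _ `&` _ = set0) ?countable0//.
  by apply/seteqP; split => // s [/= nC s01]; apply: nC; exists s.
- move=> x; pose N := [set s : R | W (- x + s *: v)].
  pose D := (fun s : R => s *: v) @` N.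
  have mD : measurable (D : set borel_type).
    apply: countable_measurable; last first.
    exact: sub_countable (card_image_le _ _) (cW _).
  by move=> z; apply: closedm; apply: accessible_closed_set1; apply: hausdorff_accessible;
    exact: norm_hausdorff.
  exists (~` C `|` D); split.
  + exact: measurableU.
  + rewrite /distribution /pushforward; apply: uniform_prob_countable.
      rewrite -[X in measurable X]setTI; apply: (mphi measurableT).
      exact: measurableU.
    apply: (sub_countable _ (cW (- x))); apply: subset_card_le.
    move=> s [/= [nC s01|[t Nt /phi_inj <-]//]].
    by exfalso; apply: nC; exists s.
  + move=> _ [z Wz <-]; have [[s s01 sz]|] := pselect (C (z + x)); last by left.
    right; exists s => //; rewrite /N /=.
    by rewrite sz addrC addrK.
Qed.

End ShyLine.

(** * Countability along ordered lines *)

Lemma separable_prod (S T : topologicalType) :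
  separable S -> separable T -> separable (S * T)%type.
Proof.
move=> [A cA dA] [C cC dC]; exists (A `*` C); first exact: countableX.
move=> O [[x y] Oxy] oO.
have [[U V] [/= Ux Vy] UVO] : nbhs (x, y) O by exact: open_nbhs_nbhs.
have [a [Ua Aa]] : (U^° `&` A) !=set0.
  by apply: dA; [exists x; exact: nbhs_singleton (nbhs_interior Ux)|exact: open_interior].
have [c [Vc Cc]] : (V^° `&` C) !=set0.
  by apply: dC; [exists y; exact: nbhs_singleton (nbhs_interior Vy)|exact: open_interior].
by exists (a, c); split => //; apply: UVO; split; exact: interior_subset.
Qed.

(** Attach to each index a radius [n.+1%:R^-1], at most half the isolation distance, and a point of
    the countable dense set within that radius; two indices with the same data would be too
    close. *)
Lemma countable_isolated {R : realType} {V : normedModType R} {T : Type}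
    (N : set T) (f : T -> V) : separable V ->
  (forall s, N s -> exists2 d : R, 0 < d &
     forall s', N s' -> s' <> s -> d <= `|f s' - f s|) ->
  countable N.
Proof.
move=> [S cS dS] H.
have /choice[h Hh] : forall s, exists nz : nat * V, N s ->
    [/\ S nz.2, `|f s - nz.2| < nz.1.+1%:R^-1 &
     forall s', N s' -> s' <> s -> 2 * nz.1.+1%:R^-1 <= `|f s' - f s|].
  move=> s; have [Ns|nNs] := pselect (N s); last by exists (0%N, 0).
  have [d d0 Hd] := H s Ns.
  have d2 : 0 < d / 2 by rewrite divr_gt0.
  have [n /= nd] := filter_ex (near_infty_natSinv_lt (PosNum d2)).
  have n0 : 0 < n.+1%:R^-1 :> R by rewrite invr_gt0.
  have [z [/= zb Sz]] : (ball (f s) (n.+1%:R^-1 : R) `&` S) !=set0.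
    by apply: dS; [exists (f s); exact: ballxx|exact: ball_open].
  exists (n, z) => _; split => //=; first by move: zb; rewrite -ball_normE.
  move=> s' Ns' s's; apply: le_trans (Hd _ Ns' s's).
  by rewrite mulrC -ler_pdivlMr// ltW.
have [g gi] := countable_injP _ (countableX (countableP [set: nat]) cS).
apply/countable_injP; exists (g \o h) => s s'; rewrite !inE => Ns Ns' /= ghs.
have [Ss fs ds] := Hh _ Ns; have [Ss' fs' ds'] := Hh _ Ns'.
have hs : h s = h s' by apply: gi ghs; rewrite inE.
apply: contrapT => ss'; have := ds' _ Ns ss'; apply/negP; rewrite -ltNge.
rewrite -(subrK (h s).2 (f s)) -addrA; apply: (le_lt_trans (ler_normD _ _)).
rewrite mulr_natl mulr2n; apply: ltrD; first by rewrite -hs.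
by rewrite hs distrC.
Qed.

Section Countability.
Context {R : realType} {B : normedModType R}.
Variables (K : set B) (hK : order_cone K) (hKint : K° !=set0).

(** The accumulation may come from either side. For [s < s'] one uses [a s <= b s'] with [b s'] near
    [b s]; for [s' < s], [a s' <= b s] with [a s'] near [a s]. The small error is absorbed by an
    order unit. *)
Lemma chain_limit_le (N : set R) (a b : R -> B) s :
  (forall s s', N s -> N s' -> s < s' -> cone_le K (a s) (b s')) -> N s ->
  (forall d : R, 0 < d -> exists s', [/\ N s', s' <> s,
     `|a s' - a s| < d & `|b s' - b s| < d]) ->
  cone_le K (a s) (b s).
Proof.
move=> ab Ns near_s; have [u Ku] := hKint.
have [c c0 Hc] := cone_unit hK Ku; have Ku' := cone_int_sub Ku.
apply: (cone_arch hK (v := u)) => e e0.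
have [s' [Ns' s's as' bs']] := near_s (e / c) (divr_gt0 e0 c0).
have shift h : `|h| < e / c -> K (h + e *: u).
  rewrite ltr_pdivlMr// mulrC => he.
  have -> : h + e *: u = (c * `|h|) *: u + h + (e - c * `|h|) *: u.
    by rewrite addrAC -scalerDl subrKC addrC.
  apply: (order_coneD hK) => //; apply: (order_coneZ hK) => //.
  by rewrite subr_ge0 ltW.
have [ss'|ss'|] := ltgtP s s'; last by move=> ss'; case: s's.
  have -> : b s - a s + e *: u = (b s' - a s) + ((b s - b s') + e *: u).
    by rewrite addrA; congr (_ + _); rewrite addrC addrA subrK.
  by apply: (order_coneD hK); [exact: ab|apply: shift; rewrite distrC].
have -> : b s - a s + e *: u = (b s - a s') + ((a s' - a s) + e *: u).
  by rewrite !addrA subrK.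
by apply: (order_coneD hK); [exact: ab|exact: shift].
Qed.

End Countability.

Lemma omega_limit_cvg {R : realType} {B : normedModType R} (X : set B)
    (Phi : R -> B -> B) x e : semiflow X Phi ->
  (forall x, X x -> compact (orbit_closure X Phi x)) -> X x ->
  omega_limit X Phi x = [set e] -> (fun t => Phi t x) @ pinfty_nbhs R --> e.
Proof.
move=> hPhi horb Xx we U Ue; rewrite /nbhs /=; apply: contrapT => nU.
pose F := within [set t | ~ U (Phi t x)] (pinfty_nbhs R).
have FP : ProperFilter F.
  apply: Build_ProperFilter => F0; apply: nU; move: F0; rewrite /F /within /=.
  by apply: filterS => t /= Ht; apply: contrapT.
have infF : pinfty_nbhs R `<=` F by move=> V; apply: filterS => t Vt _.
have [G [GP FG [p wp Gp]]] := omega_limit_refine hPhi horb Xx infF.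
move: wp Gp; rewrite we => -> Ge.
have nGU : G [set t | ~ U (Phi t x)].
  by apply: FG; rewrite /F /within /=; apply: filterE.
have [t [nUt Ut]] : exists t, ~ U (Phi t x) /\ U (Phi t x).
  by apply: (@filter_ex _ G); apply: filterI; [exact: nGU|exact: Ge].
exact: nUt.
Qed.

(** * Countability of the exceptional parameters on a line *)

Theorem theorem7 (R : realType) (B : completeNormedModType R) (K X : set B)
    (Phi : R -> B -> B) (t0 : R)
    (hsep : separable B)
    (hK : order_cone K) (hKint : K° !=set0)
    (hX : p_convex K X)
    (hPhi : semiflow X Phi)
    (hsop : strongly_order_preserving K X Phi)
    (huniq : unique_derivatives X Phi)
    (ht0 : 0 <= t0)
    (hcpt : forall t, t0 <= t -> compact_on X (Phi t))
    (hC1 : forall t, t0 <= t -> C1_on X (Phi t))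
    (hdcpt : forall t, t0 <= t -> compact_derivatives X (Phi t))
    (horb : forall x, X x -> compact (orbit_closure X Phi x))
    (hoX : order_convex K X)
    (hirr : forall e, equilibria X Phi e -> irreducible_equilibrium K X Phi e)
    (hesm : eventually_strongly_monotone K X Phi) :
  prevalent_in (stably_convergent X Phi t0) X.
Proof.
have [hmono [t1 t1_ge0 hstrong]] := hesm.
have [v Kv] := hKint.
have v0 : v != 0.
  by apply/eqP => v0; apply: (cone_int_neq0 hK); rewrite -v0.
apply: (shy_of_countable_lines v0) => y.
pose x s := y + s *: v; pose w s := omega_limit X Phi (x s).
have x_lt s s' : s < s' -> cone_lt K (x s) (x s').
  move=> ss'; rewrite /x /cone_lt /cone_le opprD addrACA subrr add0r -scalerBl.
  split; first by apply: (order_coneZ hK); [rewrite subr_ge0 ltW|exact: cone_int_sub].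
  move=> /addrI/eqP; rewrite -subr_eq0 -scalerBl scaler_eq0 (negbTE v0) orbF.
  by rewrite subr_eq0 => /eqP ss; rewrite ss ltxx in ss'.
have dichotomy s s' : X (x s) -> X (x s') -> s < s' ->
    ~ set_le K (w s) (w s') ->
    [/\ w s = w s', w s `<=` equilibria X Phi &
      (fun t => Phi t (x s') - Phi t (x s)) @ pinfty_nbhs R --> (0 : B)].
  move=> Xs Xs' /x_lt ss'.
  exact: (limit_set_dichotomy hK hPhi horb hmono t1_ge0 hstrong).
pose N1 := [set s | X (x s) /\ forall e, w s <> [set e]].
pose N2 := [set s | X (x s) /\ exists2 e, w s = [set e] &
  ~ stable_equilibria X Phi t0 e].
suff [c1 c2] : countable N1 /\ countable N2.
  have c12 : countable (N1 `|` N2).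
    by rewrite -bigcup2E; apply: bigcup_countable => // -[|[|i]] _ //=; exact: countable0.
  apply: (sub_countable _ c12); apply: subset_card_le.
  move=> s [Xs ns]; have [[e we]|ne] := pselect (exists e, w s = [set e]).
    right; split => //; exists e => // se; apply: ns; split => //.
    by exists e.
  by left; split => // e we; apply: ne; exists e.
split.
- have /choice[pq Hpq] : forall s, exists pq : B * B,
      N1 s -> [/\ w s pq.1, w s pq.2 & pq.1 <> pq.2].
    move=> s; have [[Xs ns]|] := pselect (N1 s); last by exists (0, 0).
    have [p wp] := omega_limit_neq0 hPhi horb Xs.
    have [[q wq qp]|nq] := pselect (exists2 q, w s q & q <> p).
      by exists (q, p).
    exfalso; apply: (ns p); apply/seteqP; split => [q wq|_ -> //].
    by apply: contrapT => qp; apply: nq; exists q.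
  (* The other branch of the dichotomy would reduce the limit set of [x s] to one point. *)
  have N1_le s s' : N1 s -> N1 s' -> s < s' -> set_le K (w s) (w s').
    move=> N1s N1s' ss'; apply: contrapT => nle.
    have [wp wq pq_neq] := Hpq s N1s.
    have [_ wE d0] := dichotomy s s' N1s.1 N1s'.1 ss' nle.
    apply: pq_neq; have := @omega_limit_common_single _ _ K X Phi t0 t1 hK hKint
      hPhi huniq ht0 hC1 hdcpt horb hoX hirr hmono t1_ge0 hstrong.
    by move=> /(_ _ _ _ _ N1s.1 N1s'.1 (x_lt _ _ ss') wE d0 wp wq).
  apply: (countable_isolated (f := pq) (separable_prod hsep hsep)) => s N1s.
  apply: contrapT => /forall2NP nd.
  have near_s (d : R) : 0 < d -> exists s', [/\ N1 s', s' <> s,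
      `|(pq s').1 - (pq s).1| < d & `|(pq s').2 - (pq s).2| < d].
    move=> d0; have [//|/existsNP[s' /not_implyP[Ns' /not_implyP[s's /negP]]]] := nd d.
    rewrite -ltNge prod_normE gt_max => /andP[? ?].
    by exists s'.
  (* Accumulation of the pairs at [s] gives [chain_limit_le] in both orders of the coordinates, so
     the two chosen limit points coincide. *)
  have [wp wq pq_neq] := Hpq s N1s; apply: pq_neq; apply: (cone_le_antisym hK).
    apply: (chain_limit_le hK hKint (N := N1) (a := fst \o pq) (b := snd \o pq)) => //.
    move=> r r' Nr Nr' rr'; have [wr _ _] := Hpq r Nr; have [_ wr' _] := Hpq r' Nr'.
    exact: N1_le Nr Nr' rr' _ _ wr wr'.
  apply: (chain_limit_le hK hKint (N := N1) (a := snd \o pq) (b := fst \o pq)) => //.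
    move=> r r' Nr Nr' rr'; have [_ wr _] := Hpq r Nr; have [wr' _ _] := Hpq r' Nr'.
    exact: N1_le Nr Nr' rr' _ _ wr wr'.
  by move=> d /near_s[s' [? ? ? ?]]; exists s'.
- have /choice[f Hf] : forall s, exists e, N2 s ->
      w s = [set e] /\ ~ stable_equilibria X Phi t0 e.
    move=> s; have [[Xs [e we ne]]|] := pselect (N2 s); last by exists 0.
    by exists e.
  have common s s' : N2 s -> X (x s') -> s < s' ->
      (fun t => Phi t (x s') - Phi t (x s)) @ pinfty_nbhs R --> (0 : B) -> False.
    move=> N2s Xs' ss' d0; have [we ne] := Hf s N2s; apply: ne.
    have := @stable_of_common_limit _ _ K X Phi t0 t1 hK hKint
      hPhi huniq ht0 hC1 hdcpt horb hoX hirr hmono t1_ge0 hstrong.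
    by move=> /(_ _ _ _ N2s.1 Xs' (x_lt _ _ ss') we d0).
  have f_le s s' : N2 s -> N2 s' -> s < s' -> cone_le K (f s) (f s').
    move=> N2s N2s' ss'.
    have [le_ss'|nle] := pselect (set_le K (w s) (w s')).
      by apply: le_ss'; [rewrite (Hf s N2s).1|rewrite (Hf s' N2s').1].
    have [_ _ d0] := dichotomy s s' N2s.1 N2s'.1 ss' nle.
    by exfalso; exact: common N2s N2s'.1 ss' d0.
  (* Equal limits would make the gap tend to 0, which [common] excludes. *)
  have f_inj s s' : N2 s -> N2 s' -> s < s' -> f s <> f s'.
    move=> N2s N2s' ss' ff; apply: (common s s' N2s N2s'.1 ss').
    rewrite -(subrr (f s)) {1}ff; apply: cvgB.
      exact: (omega_limit_cvg hPhi horb N2s'.1 (Hf s' N2s').1).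
    exact: (omega_limit_cvg hPhi horb N2s.1 (Hf s N2s).1).
  have fE s : N2 s -> equilibria X Phi (f s).
    move=> N2s; exact: (equilibrium_omega_limit hPhi N2s.1 (Hf s N2s).1).
  apply: (countable_isolated (f := f) hsep) => s N2s.
  apply: contrapT => /forall2NP nd; apply: (Hf s N2s).2.
  (* The limits attached to the other parameters form a set of equilibria comparable with [f s].
     Failure of isolation makes them accumulate at [f s], which would then be stable. *)
  have := @stable_of_chain _ _ K X Phi t0 t1 hK hKint
      hPhi huniq ht0 hC1 hdcpt hoX hirr hmono t1_ge0 hstrong.
  move=> /(_ (f s) [set f s' | s' in [set s' | N2 s' /\ s' <> s]]); apply.
  + exact: fE.
  + by move=> _ [s' [N2s' _] <-]; exact: fE.
  + move=> _ [s' [N2s' s's] <-]; have [ss'|ss'|ss'] := ltgtP s s'; last by case: s's.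
      by left; exact: f_le.
    by right; exact: f_le.
  + move=> d d0.
    have [//|/existsNP[s' /not_implyP[Ns' /not_implyP[s's /negP]]]] := nd d.
    rewrite -ltNge => fd; exists (f s'); split => //; first by exists s'.
    have [ss'|ss'|ss'] := ltgtP s s'; last by case: s's.
      by apply: nesym; exact: f_inj.
    exact: f_inj.
Qed.
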